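(* Assume (A1), (A2)' and (A3) (stated in the context), and let $(s,u)$ be a solution of the free boundary problem $(\mathrm{P})(u_0,s_0,b)$ on $[0,\infty)$. Then $s(t)\to\infty$ as $t\to\infty$.
   Context: Let $\sigma(r)=r$ if $r\ge 0$ and $\sigma(r)=0$ if $r<0$. Assumptions: (A1) $a_0,\gamma,\beta$ are positive constants. (A2)' $b\in W^{1,2}_{loc}([0,\infty))$, $b_t\in L^1(0,\infty)$, $\lim_{t\to\infty}b(t)=b_\infty$, $b-b_\infty\in L^1(0,\infty)$, and $b_*\le b\le b^*$ on $(0,\infty)$, where $b_*,b^*$ are positive constants. (A3) $s_0>0$ and $u_0\in H^1(0,s_0)$ with $0\le u_0\le b^*/\gamma$ on $[0,s_0]$. For $T>0$ and a positive function $s$ on $[0,T]$ put $Q_s(T)=\{(t,z): 0<t<T,\ 0<z<s(t)\}$. A pair $(s,u)$, with $s$ a function on $[0,T]$ and $u$ a function on $Q_s(T)$, is a solution of $(\mathrm{P})(u_0,s_0,b)$ on $[0,T]$ if: (S1) $s\in W^{1,\infty}(0,T)$, $s>0$ on $[0,T]$, $u\in L^\infty(Q_s(T))$, $u_t,u_{zz}\in L^2(Q_s(T))$, and $t\in[0,T]\mapsto |u_z(t,\cdot)|_{L^2(0,s(t))}$ is bounded; (S2) $u_t-u_{zz}=0$ on $Q_s(T)$; (S3) $-u_z(t,0)=\beta(b(t)-\gamma u(t,0))$ for a.e. $t\in[0,T]$; (S4) $-u_z(t,s(t))=u(t,s(t))\,s_t(t)$ for a.e. $t\in[0,T]$; (S5)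 $s_t(t)=a_0\,\sigma(u(t,s(t)))$ for a.e. $t\in[0,T]$; (S6) $s(0)=s_0$ and $u(0,z)=u_0(z)$ for $z\in[0,s_0]$. A solution on $[0,\infty)$ is a pair $(s,u)$ whose restriction to $[0,T]$ is a solution on $[0,T]$ for every $T>0$. *)

(* Defs.v *)
From HB Require Import structures.
From mathcomp Require Import all_boot all_order all_algebra.
From mathcomp Require Import all_classical all_reals all_analysis.

Set Implicit Arguments.
Unset Strict Implicit.
Unset Printing Implicit Defensive.

Import Order.TTheory GRing.Theory Num.Theory.
Import numFieldNormedType.Exports.

Local Open Scope classical_set_scope.
Local Open Scope ring_scope.

(* C^oo: every iterated directional derivative exists everywhere and is
   continuous. It is used for V = R and V = R * R, where this is the usual
   notion. *)
Definition smooth (R : realType) (V : normedModType R) (phi : V -> R) : Prop :=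
  forall vs : seq V,
    let psi := foldr (fun v f => 'D_v f) phi vs in
    continuous psi /\ forall v x, derivable psi x v.

Definition test_function (R : realType) (V : normedModType R)
    (Omega : set V) (phi : V -> R) : Prop :=
  let supp := closure [set x | phi x != 0] in
  [/\ smooth phi, compact supp & supp `<=` Omega].

Definition mu1 (R : realType) : {measure set (measurableTypeR R) -> \bar R} :=
  @lebesgue_measure R.

Definition mu2 (R : realType) :
    {measure set (measurableTypeR R * measurableTypeR R) -> \bar R} :=
  (@lebesgue_measure R \x @lebesgue_measure R)%E.

Definition Lp_norm d (T : measurableType d) (R : realType)
    (mu : {measure set T -> \bar R}) (p : \bar R) (D : set T) (f : T -> R) :
    \bar R :=
  ('N[mu]_p[(EFin \o f) \_ D])%E.

Definition Lp d (T : measurableType d) (R : realType)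
    (mu : {measure set T -> \bar R}) (p : \bar R) (D : set T) (f : T -> R) :
    Prop :=
  measurable_fun D f /\ (Lp_norm mu p D f < +oo)%E.

Definition weak_derivative1 (R : realType) (I : set R) (f g : R -> R) : Prop :=
  (forall K, compact K -> K `<=` I ->
     (mu1 R).-integrable K (EFin \o f) /\ (mu1 R).-integrable K (EFin \o g)) /\
  forall phi : R -> R, test_function I phi ->
    \int[mu1 R]_(x in I) (f x * derive1 phi x) =
    - \int[mu1 R]_(x in I) (g x * phi x).

(* v = (1, 0) and v = (0, 1) give the weak derivatives with respect to the
   first and the second variable. *)
Definition weak_derivative2 (R : realType) (Omega : set (R * R)) (v : R * R)
    (f g : R * R -> R) : Prop :=
  (forall K, compact K -> K `<=` Omega ->
     (mu2 R).-integrable K (EFin \o f) /\ (mu2 R).-integrable K (EFin \o g)) /\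
  forall phi : R * R -> R, test_function Omega phi ->
    \int[mu2 R]_(x in Omega) (f x * 'D_v phi x) =
    - \int[mu2 R]_(x in Omega) (g x * phi x).

(* f belongs to W^{1,p}(I), with weak derivative f'. *)
Definition sobolev1 (R : realType) (p : \bar R) (I : set R) (f f' : R -> R) :
    Prop :=
  [/\ Lp (mu1 R) p I f, Lp (mu1 R) p I f' & weak_derivative1 I f f'].

(* For f defined almost everywhere on ]a, c[: f has a representative continuous
   on [a, c], whose value at x is l. *)
Definition continuous_value (R : realType) (a c : R) (f : R -> R) (x l : R) :
    Prop :=
  exists w : R -> R,
    [/\ {within `[a, c], continuous w},
        {ae mu1 R, forall y, y \in `]a, c[ -> f y = w y} &
        w x = l].

Definition sigma (R : realType) (r : R) : R := if 0 <= r then r else 0.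

Definition Q (R : realType) (s : R -> R) (T : R) : set (R * R) :=
  [set x | 0 < x.1 < T /\ 0 < x.2 < s x.1].

Definition Qbar (R : realType) (s : R -> R) (T : R) : set (R * R) :=
  [set x | 0 <= x.1 <= T /\ 0 <= x.2 <= s x.1].

Definition assumption_A1 (R : realType) (a0 gamma beta : R) : Prop :=
  [/\ 0 < a0, 0 < gamma & 0 < beta].

(* Elements of one-dimensional Sobolev spaces are identified with their
   continuous representatives, up to the endpoints. *)
Definition assumption_A2' (R : realType) (b : R -> R)
    (b_inf b_low b_up : R) : Prop :=
  [/\ {within `[0, +oo[, continuous b},
      exists b_t : R -> R,
        (forall T, 0 < T -> sobolev1 2%:E `]0, T[ b b_t) /\
        Lp (mu1 R) 1%:E `]0, +oo[ b_t,
      b t @[t --> +oo] --> b_inf,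
      Lp (mu1 R) 1%:E `]0, +oo[ (fun t => b t - b_inf) &
      [/\ 0 < b_low, 0 < b_up & forall t, 0 < t -> b_low <= b t <= b_up]].

Definition assumption_A3 (R : realType) (gamma b_up s0 : R) (u0 : R -> R) :
    Prop :=
  [/\ 0 < s0,
      {within `[0, s0], continuous u0},
      exists u0_z : R -> R, sobolev1 2%:E `]0, s0[ u0 u0_z &
      forall z, 0 <= z <= s0 -> 0 <= u0 z <= b_up / gamma].

(* Under the regularity required of s and u (first group of conditions), s and u
   have unique representatives continuous on [0, T], respectively on the closure
   of Q s T: in the fixed-domain coordinate y = z / s t, u belongs to both
   H^1(0, T; L^2(0, 1)) and L^oo(0, T; H^1(0, 1)), hence to C([0, T] * [0, 1]).
   The values s t, u (t, 0), u (t, s t) and u (0, z)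
   refer to these representatives, so s and u denote them. The values of u_z
   at z = 0 and z = s t refer to the continuous representative of u_z (t, _),
   which belongs to H^1(0, s t) for almost every t. *)
Definition solution_on (R : realType) (a0 gamma beta : R) (u0 : R -> R)
    (s0 : R) (b : R -> R) (T : R) (s : R -> R) (u : R * R -> R) : Prop :=
  exists (s_t : R -> R) (u_t u_z u_zz : R * R -> R),
    [/\ [/\ {within `[0, T], continuous s},
            sobolev1 +oo%E `]0, T[ s s_t &
            forall t, 0 <= t <= T -> 0 < s t],
        [/\ {within Qbar s T, continuous u},
            Lp (mu2 R) +oo%E (Q s T) u,
            weak_derivative2 (Q s T) (1, 0) u u_t /\
              Lp (mu2 R) 2%:E (Q s T) u_t,
            weak_derivative2 (Q s T) (0, 1) u u_z &
            weak_derivative2 (Q s T) (0, 1) u_z u_zz /\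
              Lp (mu2 R) 2%:E (Q s T) u_zz] &
        (forall t, 0 <= t <= T ->
           sobolev1 2%:E `]0, s t[ (fun z => u (t, z)) (fun z => u_z (t, z))) /\
        exists M : R, forall t, 0 <= t <= T ->
          (Lp_norm (mu1 R) 2%:E `]0%R, s t[ (fun z => u_z (t, z)) <= M%:E)%E]
    /\
    [/\ {ae mu2 R, forall x, Q s T x -> u_t x - u_zz x = 0},
        {ae mu1 R, forall t, 0 <= t <= T ->
           exists2 l, continuous_value 0 (s t) (fun z => u_z (t, z)) 0 l &
             - l = beta * (b t - gamma * u (t, 0))},
        {ae mu1 R, forall t, 0 <= t <= T ->
           exists2 l, continuous_value 0 (s t) (fun z => u_z (t, z)) (s t) l &
             - l = u (t, s t) * s_t t},
        {ae mu1 R, forall t, 0 <= t <= T -> s_t t = a0 * sigma (u (t, s t))} &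
        s 0 = s0 /\ forall z, 0 <= z <= s0 -> u (0, z) = u0 z].

Definition solution (R : realType) (a0 gamma beta : R) (u0 : R -> R)
    (s0 : R) (b : R -> R) (s : R -> R) (u : R * R -> R) : Prop :=
  forall T, 0 < T -> solution_on a0 gamma beta u0 s0 b T s u.

(* Main.v *)
(** With [k = beta * gamma] and [eps = 2 * gamma / b_up], put
    [G(z, r) = (1 + k * z) * r - eps * r^2 / 2] and let [E(t)] be the integral
    of [G(z, u(t, z))] over [0 < z < s(t)]. Testing the heat equation with
    [1 + k * z - eps * u] makes the boundary terms [k * u(t, 0)] cancel, and
    completing the square in [u(t, 0)] leaves
    [E'(t) >= beta * b_low / 2 - (k / a0) * s'(t)]. On the other hand
    [G(z, r) <= (1 + k * z)^2 / (2 * eps)] for every [r], so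
    [E(t) <= s(t) * (1 + k * s(t))^2 / (2 * eps)]. Hence a cubic polynomial in
    [s(t)] grows at least linearly in [t]; no maximum principle is needed.

    Since [u] is only weakly differentiable and its domain moves, the inequality
    for [E'] is integrated through increments: over a short slab [x <= t <= y]
    the increment of [E(t) - c * t + (k / a0) * s(t)], where
    [c = beta * b_low / 2], is at least [- eta] times the increment of a fixed
    function, and the errors are summed over finer and finer partitions. *)

(* The weight [1 + k * z] is harmonic and fits the condition at [z = 0]: paired with [u] alone it
   yields the influx [beta * b] and a loss [k * u] at the free boundary, which is at most
   [(k / a0) * s'] whatever the sign of [u], because [r <= sigma r]. Comparing the resulting
   functional with [s] would require an upper bound on [u]. The concave correction [- eps * r^2 / 2]
   bounds the density instead, at the price of [eps * beta * b^2 / (4 * gamma)] in the growth rate;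
   the value of [eps] turns this into [beta * b^2 / (2 * b_up)], at most half the influx. At the
   moving end the correction leaves [eps * u^2 * s' / 2], which has the good sign.

   Weak identities on a noncylindrical open set give no derivative of an integral over the moving
   slice, so they are reduced to increment formulas along almost every line. The energy increment
   over a slab then compares two planar integrals, obtained by Fubini in opposite orders. Their
   domains differ by a strip inside a rectangle of area [(y - x) * (s y - s x)], negligible against
   [s y - s x]. *)
Require Import Defs.
From mathcomp Require Import all_boot all_order all_algebra.
From mathcomp Require Import all_classical all_reals all_analysis.
From mathcomp Require Import measurable_realfun.
From mathcomp Require Import ring lra.
Set Implicit Arguments.
Unset Strict Implicit.
Unset Printing Implicit Defensive.
Import Order.TTheory GRing.Theory Num.Theory.
Import numFieldNormedType.Exports.
Local Open Scope classical_set_scope.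
Local Open Scope ring_scope.

(** * Smooth test functions *)

(* [Ck n] for every [n] gives [smooth] and, unlike [smooth], is stable under
   products by a plain induction on [n]. *)
Section Ck_definition.
Context {R : realType} {V : normedModType R}.

Fixpoint Ck (n : nat) (f : V -> R) : Prop :=
  match n with
  | 0 => continuous f
  | m.+1 => [/\ continuous f, forall x v, derivable f x v &
                forall v, Ck m ('D_v f)]
  end.

End Ck_definition.

Section Ck_theory.
Variables (R : realType) (V : normedModType R).
Implicit Types (f g : V -> R) (n : nat).

Lemma Ck_continuous n f : Ck n f -> continuous f.
Proof. by case: n => [|n] //= []. Qed.

Lemma CkS n f : Ck n.+1 f -> Ck n f.
Proof.
elim: n f => [|n IH] f; first by case.
by move=> [cf df Df]; split=> // v; exact/IH/Df.
Qed.

Lemma Ck_smooth f : (forall n, Ck n f) -> smooth f.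
Proof.
move=> Cf; suff H vs : forall n, Ck n (foldr (fun v g => 'D_v g) f vs).
  by move=> vs; split; [exact: Ck_continuous (H vs 0%N)|move=> v x; have [] := H vs 1].
elim: vs => [|v vs IH] n //=.
by have [_ _] := IH n.+1; exact.
Qed.

Lemma Ck_cst n (c : R) : Ck n (cst c : V -> R).
Proof.
elim: n c => [|n IH] c /=; first exact: cst_continuous.
split; [exact: cst_continuous|by move=> x v; exact: derivable_cst|].
move=> v; rewrite (_ : 'D_v _ = cst 0) //.
by apply/funext => x; rewrite derive_cst.
Qed.

Lemma CkD n f g : Ck n f -> Ck n g -> Ck n (f + g).
Proof.
elim: n f g => [|n IH] f g /=.
  by move=> cf cg x; exact: (cvgD (cf x) (cg x)).
move=> [cf df Df] [cg dg Dg]; split.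
- by move=> x; exact: (cvgD (cf x) (cg x)).
- by move=> x v; exact: derivableD.
- move=> v; rewrite (_ : 'D_v _ = 'D_v f + 'D_v g); first exact: IH.
  by apply/funext => x; rewrite deriveD.
Qed.

Lemma CkM n f g : Ck n f -> Ck n g -> Ck n (f * g).
Proof.
elim: n f g => [|n IH] f g.
  by move=> cf cg x; exact: (cvgM (cf x) (cg x)).
move=> Cf Cg; have := CkS Cf; have := CkS Cg.
move: Cf Cg => /= [cf df Df] [cg dg Dg] Cg Cf; split.
- by move=> x; exact: (cvgM (cf x) (cg x)).
- by move=> x v; exact: derivableM.
- move=> v; rewrite (_ : 'D_v _ = f * 'D_v g + g * 'D_v f).
    by apply: CkD; exact: IH.
  by apply/funext => x; rewrite deriveM.
Qed.

Lemma CkZ n (c : R) f : Ck n f -> Ck n (fun x => c * f x).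
Proof. by move=> Cf; exact: (CkM (Ck_cst n c) Cf). Qed.

Lemma CkN n f : Ck n f -> Ck n (- f).
Proof.
move=> Cf; have := CkZ (-1) Cf.
by congr (Ck n _); apply/funext => x; rewrite mulN1r.
Qed.

(** The derivative of [1 / f] is [- f' / f^2], a product of functions already known to be of class
    [Ck n], so the induction closes through [CkM]. *)
Lemma CkV n f : (forall x, f x != 0) -> Ck n f -> Ck n (fun x => (f x)^-1).
Proof.
move=> f0; elim: n => [|n IH].
  by move=> cf x; exact: (cvgV (f0 x) (cf x)).
move=> Cf; have := CkS Cf.
move: Cf => /= [cf df Df] Cf; split.
- by move=> x; exact: (cvgV (f0 x) (cf x)).
- by move=> x v; exact: derivableV.
- move=> v; rewrite (_ : 'D_v _ = (fun x => (f x)^-1) * (fun x => (f x)^-1) * - 'D_v f).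
    by apply: CkM; [apply: CkM; exact: IH|exact/CkN/Df].
  apply/funext => x; rewrite deriveV//.
  by rewrite /GRing.scale/= [RHS]mulrN mulNr -exprVn expr2.
Qed.

End Ck_theory.

(** The difference quotient of the composite along [v] is literally that of [f] along [c * v] at
    [c * (x - a)]. Since [Ck] quantifies over all directions, the induction absorbs the rescaled
    direction without a chain rule. *)
Lemma Ck_affine (R : realType) n (f : R -> R) (c a : R) :
  Ck n f -> Ck n (fun x => f (c * (x - a))).
Proof.
have cA : continuous (fun x : R => c * (x - a)).
  by move=> x; apply: cvgM; [exact: cvg_cst|apply: cvgB; [exact: cvg_id|exact: cvg_cst]].
have E (g : R -> R) (x v : R) :
    (fun h : R => h^-1 *: (g (c * (h *: v + x - a)) - g (c * (x - a)))) =
    (fun h : R => h^-1 *: (g (h *: (c * v) + c * (x - a)) - g (c * (x - a)))).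
  apply/funext => h; congr (_ *: (g _ - _)).
  by rewrite /GRing.scale/=; ring.
elim: n f => [|n IH] f /=.
  by move=> cf x; apply: (@continuous_comp _ _ _ (fun x : R => c * (x - a)) f); [exact: cA|exact: cf].
move=> [cf df Df]; split.
- by move=> x; apply: (@continuous_comp _ _ _ (fun x : R => c * (x - a)) f); [exact: cA|exact: cf].
- by move=> x v; rewrite /derivable E; exact: df.
- move=> v; rewrite (_ : 'D_v _ = (fun x => 'D_(c * v) f (c * (x - a)))).
    exact: (IH ('D_(c * v) f)).
  by apply/funext => x; rewrite {1}/derive E.
Qed.

(** The difference quotient along [v] is convertible to that of [f] along [v.1], so derivability and
    the derivative transfer by computation alone. *)
Lemma Ck_fst (R : realType) n (f : R -> R) : Ck n f -> Ck n (fun x : R * R => f x.1).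
Proof.
elim: n f => [|n IH] f /=.
  by move=> cf x; apply: (@continuous_comp _ _ _ fst f); [exact: cvg_fst|exact: cf].
move=> [cf df Df]; split.
- by move=> x; apply: (@continuous_comp _ _ _ fst f); [exact: cvg_fst|exact: cf].
- by move=> x v; exact: df.
- by move=> v; exact: (IH _ (Df v.1)).
Qed.

Lemma Ck_snd (R : realType) n (f : R -> R) : Ck n f -> Ck n (fun x : R * R => f x.2).
Proof.
elim: n f => [|n IH] f /=.
  by move=> cf x; apply: (@continuous_comp _ _ _ snd f); [exact: cvg_snd|exact: cf].
move=> [cf df Df]; split.
- by move=> x; apply: (@continuous_comp _ _ _ snd f); [exact: cvg_snd|exact: cf].
- by move=> x v; exact: df.
- by move=> v; exact: (IH _ (Df v.2)).
Qed.

Lemma is_derive1_dir (R : realType) (f g : R -> R) :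
  (forall x : R, is_derive x 1 f (g x)) ->
  (forall x v : R, derivable f x v) /\ forall v, 'D_v f = (fun x => v * g x).
Proof.
move=> fg; have df x : differentiable f x by apply/derivable1_diffP; have [] := fg x.
split=> [x v|v]; first exact: diff_derivable.
apply/funext => x; rewrite deriveE// -[v in LHS]mulr1 linearZ/= -deriveE//.
by rewrite derive_val.
Qed.

(** * Flat functions, smooth steps and plateaux *)

Lemma expr_le_fact_expR (R : realType) (n : nat) (x : R) :
  0 <= x -> x ^+ n <= n`!%:R * expR x.
Proof.
move=> x0; case: n => [|n].
  by rewrite expr0 fact0 mul1r; have := expR_ge1Dx x; lra.
rewrite mulrC -ler_pdivrMr ?ltr0n ?fact_gt0//.
by apply: le_trans (expR_ge1Dxn n x0); lra.
Qed.

(* Powers of [x^-1] are included so that the derivative of [flat k] is again a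
   combination of functions of the family. *)
Definition flat (R : realType) (k : nat) (x : R) : R :=
  if 0 < x then (x^-1) ^+ k * expR (- x^-1) else 0.

Section flat_theory.
Variable R : realType.
Implicit Types (k n : nat) (x : R).

Lemma flat_le0 k x : x <= 0 -> flat k x = 0.
Proof. by rewrite /flat ltNge => ->. Qed.

Lemma flat_ge0 k x : 0 <= flat k x.
Proof.
rewrite /flat; case: ifP => // x0.
by rewrite mulr_ge0 ?expR_ge0// exprn_ge0// invr_ge0 ltW.
Qed.

Lemma flat_gt0 k x : 0 < x -> 0 < flat k x.
Proof.
by move=> x0; rewrite /flat x0 mulr_gt0 ?expR_gt0// exprn_gt0// invr_gt0.
Qed.

(** Two powers of [x] are traded for two more powers of [x^-1], which [expR x^-1] dominates. A
    quadratic bound is what makes the difference quotients at 0 vanish in the limit. *)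
Lemma flat_le_sqr k x : `|flat k x| <= (k.+2)`!%:R * x ^+ 2.
Proof.
rewrite ger0_norm ?flat_ge0// /flat; case: ifPn => [x0|_]; last first.
  by rewrite mulr_ge0 ?sqr_ge0 ?ler0n.
rewrite expRN ler_pdivrMr ?expR_gt0//.
have xi0 : 0 <= x^-1 by rewrite invr_ge0 ltW.
have -> : (x^-1) ^+ k = (x^-1) ^+ k.+2 * x ^+ 2.
  by rewrite -addn2 exprD -mulrA -exprMn mulVf ?gt_eqF// expr1n mulr1.
rewrite [leRHS]mulrAC ler_wpM2r ?sqr_ge0//.
exact: expr_le_fact_expR.
Qed.

Lemma is_derive1M (f g : R -> R) x (a b : R) : is_derive x 1 f a ->
  is_derive x 1 g b -> is_derive x 1 (fun y => f y * g y) (a * g x + f x * b).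
Proof.
move=> fa gb; rewrite (_ : _ + _ = f x *: b + g x *: a); first exact: is_deriveM.
by rewrite /GRing.scale/=; ring.
Qed.

Lemma flat_derive0 k : is_derive (0 : R) 1 (flat k) 0.
Proof.
suff H : (fun h : R => h^-1 *: (flat k (h *: (1:R) + 0) - flat k 0)) @ 0^' --> (0 : R).
  by apply: DeriveDef; [apply/cvg_ex; exists 0|apply/cvg_lim].
have E : (fun h : R => h^-1 *: (flat k (h *: (1:R) + 0) - flat k 0)) =
   (fun h : R => h^-1 * flat k h).
  by apply/funext => h; rewrite (@flat_le0 k 0)//// subr0 addr0 /GRing.scale/= mulr1.
rewrite E; apply/norm_cvg0P.
apply: (@squeeze_cvgr _ _ _ _ (cst 0) (fun h : R => (k.+2)`!%:R * `|h|)).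
- near=> h; rewrite normr_ge0/= normrM normfV.
  have h0 : 0 < `|h| by rewrite normr_gt0; near: h; exact: nbhs_dnbhs_neq.
  rewrite mulrC ler_pdivrMr// -mulrA -expr2 real_normK ?num_real//.
  exact: flat_le_sqr.
- exact: cvg_cst.
- rewrite -[X in _ --> X](mulr0 ((k.+2)`!%:R : R)); apply: cvgMr.
  rewrite -[X in _ --> X](@normr0 R R); apply: cvg_within_filter.
  exact: (@norm_continuous _ R 0).
Unshelve. all: by end_near. Qed.

Lemma flat_derive k x : is_derive x 1 (flat k) (flat k.+2 x - k%:R * flat k.+1 x).
Proof.
have [x0|x0|->] := ltgtP x 0.
- rewrite !flat_le0 ?ltW// mulr0 subr0.
  apply: (near_eq_is_derive (f := cst 0)) => //.
  by near=> y; rewrite flat_le0//; apply/ltW; near: y; exact: lt_nbhsl.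
- have xn0 : x != 0 by rewrite gt_eqF.
  apply: (near_eq_is_derive (f := fun y : R => (y^-1) ^+ k * expR (- y^-1))) => //.
    by near=> y; rewrite /flat ifT//; near: y; exact: lt_nbhsr.
  have dV : is_derive x 1 (fun y : R => y^-1) (- x ^- 2).
    by apply: (is_derive_eq (is_deriveV xn0 (is_derive_id _ _))); rewrite /GRing.scale/= mulr1.
  have dE : is_derive x 1 (fun y : R => expR (- y^-1)) (expR (- x^-1) * x ^- 2).
    have dN : is_derive x 1 (fun y : R => - y^-1) (x ^- 2).
      by rewrite -[x ^- 2]opprK; exact: is_deriveN.
    exact: (is_derive1_comp (is_derive_expR _) dN).
  have dX : is_derive x 1 (fun y : R => y^-1 ^+ k) (- (k%:R * x^-1 ^+ k.+1)).
    clear dE; elim: k => [|k IH].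
      rewrite mul0r oppr0; exact: is_derive_cst.
    under eq_fun do rewrite exprS.
    apply: (is_derive_eq (is_derive1M dV IH)).
    by rewrite -exprVn -(natr1 k) !exprS; ring.
  apply: (is_derive_eq (is_derive1M dX dE)).
  by rewrite /flat x0 -exprVn !exprS; ring.
- rewrite !flat_le0// mulr0 subr0; exact: flat_derive0.
Unshelve. all: by end_near. Qed.

Lemma Ck_flat n k : Ck n (flat k : R -> R).
Proof.
elim: n k => [|n IH] k.
  by move=> x; apply: differentiable_continuous; apply/derivable1_diffP;
     have [] := flat_derive k x.
have [df Df] := is_derive1_dir (flat_derive k).
split.
- by move=> x; exact/differentiable_continuous/derivable1_diffP.
- by [].
- move=> v; rewrite Df; apply: CkZ; apply: CkD; first exact: IH.
  by apply: CkN; exact: CkZ.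
Qed.

End flat_theory.

Definition smooth_step (R : realType) (x : R) : R :=
  flat 0 x / (flat 0 x + flat 0 (1 - x)).
Arguments smooth_step {R} x.

Section smooth_step_theory.
Variable R : realType.
Implicit Types x : R.

Let den_gt0 x : 0 < flat 0 x + flat 0 (1 - x).
Proof.
have [x0|x0] := ltP 0 x.
  by rewrite ltr_pwDl ?flat_gt0 ?flat_ge0.
by rewrite ltr_wpDl ?flat_ge0 ?flat_gt0//; lra.
Qed.

Lemma smooth_step_le0 x : x <= 0 -> smooth_step x = 0.
Proof. by move=> x0; rewrite /smooth_step flat_le0// mul0r. Qed.

Lemma smooth_step_ge1 x : 1 <= x -> smooth_step x = 1.
Proof.
move=> x1; rewrite /smooth_step (@flat_le0 _ 0 (1 - x)) ?subr_le0// addr0.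
by rewrite divff// gt_eqF// flat_gt0//; lra.
Qed.

Lemma smooth_step_itv x : 0 <= smooth_step x <= 1.
Proof.
rewrite /smooth_step divr_ge0 ?flat_ge0 ?(ltW (den_gt0 _))//=.
by rewrite ler_pdivrMr// mul1r lerDl flat_ge0.
Qed.

Lemma Ck_smooth_step n : Ck n (smooth_step : R -> R).
Proof.
apply: CkM; first exact: Ck_flat.
apply: CkV; first by move=> x; rewrite gt_eqF.
apply: CkD; first exact: Ck_flat.
rewrite (_ : (fun x => _) = fun x => flat 0 (-1 * (x - 1))).
  by apply: Ck_affine; exact: Ck_flat.
by apply/funext => x; congr flat; ring.
Qed.

End smooth_step_theory.

(** After cross-multiplication the claim is [flat 0 x * flat 0 (1 - y) <= flat 0 y * flat 0 (1 -
    x)], which holds factor by factor. It makes the derivatives of the steps nonnegative, hence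
    averaging kernels. *)
Lemma smooth_step_nondecreasing (R : realType) :
  {homo (smooth_step : R -> R) : x y / x <= y}.
Proof.
have flat0_le (x y : R) : x <= y -> flat 0 x <= flat 0 y.
  move=> xy; have [y0|y0] := leP y 0.
    by rewrite !flat_le0// (le_trans xy).
  have [x0|x0] := leP x 0; first by rewrite flat_le0// flat_ge0.
  by rewrite /flat x0 y0 !expr0 !mul1r ler_expR lerN2 lef_pV2.
have den (x : R) : 0 < flat 0 x + flat 0 (1 - x).
  have [x0|x0] := ltP 0 x; first by rewrite ltr_pwDl ?flat_gt0 ?flat_ge0.
  by rewrite ltr_wpDl ?flat_ge0 ?flat_gt0//; lra.
move=> x y xy; rewrite /smooth_step ler_pdivrMr// mulrAC ler_pdivlMr//.
rewrite !mulrDr mulrC lerD2l; apply: ler_pM; rewrite ?flat_ge0 ?flat0_le//.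
by lra.
Qed.

Lemma nondecreasing_derive1_ge0 (R : realType) (f : R -> R) (x : R) :
  {homo f : x y / x <= y} -> derivable f x 1 -> 0 <= derive1 f x.
Proof.
move=> fle df; rewrite derive1E; apply: limr_ge => //.
near=> h; have h0 : h != 0 by near: h; exact: nbhs_dnbhs_neq.
rewrite /GRing.scale/= mulr1; have [hn|hp|] := ltgtP h 0; last by move/eqP; rewrite (negbTE h0).
  by rewrite mulr_le0 ?invr_le0 ?(ltW hn)// subr_le0 fle// gerDr ltW.
by rewrite mulr_ge0 ?invr_ge0 ?(ltW hp)// subr_ge0 fle// lerDr ltW.
Unshelve. all: by end_near. Qed.

(* Smooth approximations of the indicators of [`]a, +oo[] and [`]a, c]]. *)
Definition scaled_step (R : realType) (n : nat) (a x : R) : R :=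
  smooth_step (n.+1%:R * (x - a)).

Definition plateau (R : realType) (n : nat) (a c x : R) : R :=
  scaled_step n a x - scaled_step n c x.

Section plateau_theory.
Variable R : realType.
Implicit Types (n : nat) (a c x : R).

Lemma Ck_scaled_step m n a : Ck m (scaled_step n a : R -> R).
Proof. exact: (Ck_affine _ _ (Ck_smooth_step _ _)). Qed.

Lemma Ck_plateau m n a c : Ck m (plateau n a c : R -> R).
Proof. by apply: CkD; [|apply: CkN]; exact: Ck_scaled_step. Qed.

Lemma scaled_step_itv n a x : 0 <= scaled_step n a x <= 1.
Proof. exact: smooth_step_itv. Qed.

Lemma scaled_step_le n a x : x <= a -> scaled_step n a x = 0.
Proof. by move=> xa; rewrite /scaled_step smooth_step_le0// mulr_ge0_le0// subr_le0. Qed.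

Lemma scaled_step_ge n a x : a + n.+1%:R^-1 <= x -> scaled_step n a x = 1.
Proof.
move=> ax; rewrite /scaled_step smooth_step_ge1// mulrC -ler_pdivrMr ?ltr0n// mul1r.
by rewrite lerBrDl.
Qed.

Lemma scaled_step_nondecreasing n a : {homo (scaled_step n a) : x y / x <= y}.
Proof.
by move=> x y xy; apply: smooth_step_nondecreasing; rewrite ler_pM2l ?ltr0n// lerB.
Qed.

Lemma scaled_step_derivable n a x : derivable (scaled_step n a) x 1.
Proof. by have [_ + _] := Ck_scaled_step 1 n a; exact. Qed.

Lemma scaled_step_continuous n a : continuous (scaled_step n a).
Proof. exact: (Ck_continuous (Ck_scaled_step 0 n a)). Qed.

Lemma scaled_step_derive1_continuous n a : continuous (derive1 (scaled_step n a)).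
Proof.
have [_ _ /(_ 1) /=] := Ck_scaled_step 1 n a.
by have -> : derive1 (scaled_step n a) = 'D_(1 : R) (scaled_step n a) by apply/funext => x; rewrite derive1E.
Qed.

Lemma scaled_step_derive1_ge0 n a x : 0 <= (derive1 (scaled_step n a)) x.
Proof.
apply: nondecreasing_derive1_ge0; first exact: scaled_step_nondecreasing.
exact: scaled_step_derivable.
Qed.

Lemma scaled_step_derive1_eq0 n a x :
  x \notin `[a, a + n.+1%:R^-1] -> (derive1 (scaled_step n a)) x = 0.
Proof.
rewrite in_itv/= negb_and -!ltNge derive1E => /orP[xa|xa].
- rewrite (@near_eq_derive _ _ _ _ (cst (0 : R))) ?derive_cst//.
  by near=> y; rewrite scaled_step_le//; apply/ltW; near: y; exact: lt_nbhsl.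
- rewrite (@near_eq_derive _ _ _ _ (cst (1 : R))) ?derive_cst//.
  by near=> y; rewrite scaled_step_ge//; apply/ltW; near: y; exact: lt_nbhsr.
Unshelve. all: by end_near. Qed.

(** Every step vanishes at [a] itself, hence the strict inequality in the limit. This is why the
    increment formulas below are written over half-open intervals []x, y]]. *)
Lemma scaled_step_cvg a x : scaled_step n a x @[n --> \oo] --> ((a < x)%R%:R : R).
Proof.
have [ax|xa] := ltP a x; last first.
  by under eq_fun do rewrite scaled_step_le//; exact: cvg_cst.
apply: cvg_near_cst; have xa0 : 0 < x - a by rewrite subr_gt0.
near=> n; rewrite scaled_step_ge// -lerBrDl ltW//.
by near: n; exact: (near_infty_natSinv_lt (PosNum xa0)).
Unshelve. all: by end_near. Qed.

End plateau_theory.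

Lemma Rintegral_dominated_convergence d (T : measurableType d) (R : realType)
    (mu : {measure set T -> \bar R}) (D : set T) (f_ : nat -> T -> R) (f g : T -> R) :
  measurable D -> (forall n, measurable_fun D (f_ n)) ->
  (forall x, D x -> f_ n x @[n --> \oo] --> f x) ->
  mu.-integrable D (EFin \o g) ->
  (forall n x, D x -> `|f_ n x| <= g x) ->
  mu.-integrable D (EFin \o f) /\
  \int[mu]_(x in D) f_ n x @[n --> \oo] --> \int[mu]_(x in D) f x.
Proof.
move=> mD mf ff ig fg.
have [||||intf _ cf] := @dominated_convergence _ _ _ mu D mD
    (fun n => EFin \o f_ n) (EFin \o f) (EFin \o g) _ _ _ ig.
- by move=> n; exact/measurable_EFinP.
- by apply/measurable_EFinP; exact: (measurable_fun_cvg mf ff).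
- by apply: aeW => x Dx; apply: cvg_EFin; [exact: nearW|exact: ff].
- by apply: aeW => x n Dx; rewrite lee_fin; exact: fg.
split => //; apply: fine_cvg; rewrite fineK//.
exact: integrable_fin_num.
Qed.

Lemma Rintegral_subset_eq0 d (T : measurableType d) (R : realType)
    (nu : {measure set T -> \bar R})
    (K D : set T) (h : T -> R) : K `<=` D ->
  (forall x, ~ K x -> h x = 0) -> \int[nu]_(x in D) h x = \int[nu]_(x in K) h x.
Proof.
move=> KD h0; rewrite Rintegral_mkcond [RHS]Rintegral_mkcond.
apply: eq_Rintegral => x _; rewrite !patchE.
have [xK|xK] := boolP (x \in K).
  by rewrite mem_set//; apply: KD; exact: set_mem.
by case: ifP => // _; apply: h0 => Kx; rewrite mem_set in xK.
Qed.

(** * Weak derivatives on the line *)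

Section fundamental_lemma.
Variable R : realType.
Notation mu := (@lebesgue_measure R).
Implicit Types (f g : R -> R) (a c e r x y : R).

Lemma integrable_continuous f a c : continuous f -> mu.-integrable `[a, c] (EFin \o f).
Proof.
move=> cf; apply: continuous_compact_integrable; first exact: segment_compact.
exact: continuous_subspaceT.
Qed.

Lemma Rintegral_scaled_step_derive1 n a c e : a <= c -> c + n.+1%:R^-1 <= e ->
  \int[mu]_(x in `[a, e]) derive1 (scaled_step n c) x = 1.
Proof.
move=> ac ce; have ae : a < e.
  by rewrite (lt_le_trans _ ce)// (le_lt_trans ac)// ltrDl invr_gt0 ltr0n.
rewrite /Rintegral (@continuous_FTC2 _ _ (scaled_step n c))//=.
- by rewrite scaled_step_ge// scaled_step_le// subr0.
- exact/continuous_subspaceT/scaled_step_derive1_continuous.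
- split; first by move=> x _; exact: scaled_step_derivable.
  + by apply: cvg_at_right_filter; exact: scaled_step_continuous.
  + by apply: cvg_at_left_filter; exact: scaled_step_continuous.
Qed.

(** The derivative of the step is a nonnegative kernel of mass 1 carried by [[c, c + n.+1%:R^-1]].
    It lies to the right of [c], so the case [a = c] is allowed and room is required only on the
    right. *)
Lemma Rintegral_scaled_step_cvg f a c e : continuous f -> a <= c -> c < e ->
  \int[mu]_(x in `[a, e]) (f x * derive1 (scaled_step n c) x) @[n --> \oo] --> f c.
Proof.
move=> cf ac ce; apply/cvgrPdist_le => eps eps0.
have /cvgrPdist_le /(_ _ eps0) /nbhs_ballP [r /= r0 fr] := cf c.
have ece : 0 < e - c by rewrite subr_gt0.
near=> n.
have n0 : 0 < n.+1%:R^-1 :> R by rewrite invr_gt0 ltr0n.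
have nr : n.+1%:R^-1 < r by near: n; exact: (near_infty_natSinv_lt (PosNum r0)).
have ne : c + n.+1%:R^-1 <= e.
  rewrite -lerBrDl ltW//; near: n; exact: (near_infty_natSinv_lt (PosNum ece)).
have cd := @scaled_step_derive1_continuous R n c.
have id := @integrable_continuous _ a e cd.
have ifd : mu.-integrable `[a, e] (EFin \o (fun x => f x * derive1 (scaled_step n c) x)).
  by apply: integrable_continuous => x; apply: cvgM; [exact: cf|exact: cd].
have -> : f c = \int[mu]_(x in `[a, e]) (f c * derive1 (scaled_step n c) x).
  by rewrite RintegralZl// Rintegral_scaled_step_derive1// mulr1.
have ifc : mu.-integrable `[a, e] (EFin \o (fun x => f c * derive1 (scaled_step n c) x)).
  by apply: integrable_continuous => x; apply: cvgM; [exact: cvg_cst|exact: cd].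
rewrite -RintegralB//; apply: le_trans (le_normr_Rintegral _ _) _ => //.
  by apply: integrable_continuous => x; apply: cvgB; apply: cvgM;
    [exact: cvg_cst|exact: cd|exact: cf|exact: cd].
have -> : eps = \int[mu]_(x in `[a, e]) (eps * derive1 (scaled_step n c) x).
  by rewrite RintegralZl// Rintegral_scaled_step_derive1// mulr1.
apply: le_Rintegral => //.
- apply: integrable_continuous => x; apply: cvg_norm; apply: cvgB; apply: cvgM;
    [exact: cvg_cst|exact: cd|exact: cf|exact: cd].
- by apply: integrable_continuous => x; apply: cvgM; [exact: cvg_cst|exact: cd].
move=> x _; rewrite -mulrBl normrM (ger0_norm (scaled_step_derive1_ge0 _ _ _)).
have [xc|xc] := boolP (x \in `[c, c + n.+1%:R^-1]); last first.
  by rewrite scaled_step_derive1_eq0// !mulr0.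
rewrite ler_wpM2r ?scaled_step_derive1_ge0//; apply: fr => /=.
by move: xc; rewrite in_itv/= /ball/= => /andP[cx xc];
  rewrite distrC ger0_norm ?subr_ge0// ltrBlDl (le_lt_trans xc)// ltrD2l.
Unshelve. all: by end_near. Qed.


Lemma plateau_le1 n a c x : `|plateau n a c x| <= 1.
Proof.
have /andP[? ?] := scaled_step_itv n a x; have /andP[? ?] := scaled_step_itv n c x.
by rewrite ler_norml /plateau; lra.
Qed.

Lemma plateau_eq0 n a c x : a <= c -> x \notin `[a, c + n.+1%:R^-1] -> plateau n a c x = 0.
Proof.
move=> ac; rewrite in_itv/= negb_and -!ltNge /plateau => /orP[xa|xc].
  by rewrite !scaled_step_le ?subrr// ltW// (lt_le_trans xa).
by rewrite !scaled_step_ge ?subrr// ltW// (le_lt_trans _ xc)// lerD2r.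
Qed.

Lemma derive1_plateau n a c x :
  derive1 (plateau n a c) x = derive1 (scaled_step n a) x - derive1 (scaled_step n c) x.
Proof. by rewrite !derive1E deriveB//; exact: scaled_step_derivable. Qed.

Lemma plateau_continuous n a c : continuous (plateau n a c : R -> R).
Proof. exact: (Ck_continuous (Ck_plateau 0 n a c)). Qed.

Lemma derive1_plateau_continuous n a c : continuous (derive1 (plateau n a c) : R -> R).
Proof.
rewrite (_ : derive1 _ = fun x => derive1 (scaled_step n a) x - derive1 (scaled_step n c) x).
  by move=> x; apply: cvgB; exact: scaled_step_derive1_continuous.
by apply/funext => x; exact: derive1_plateau.
Qed.

Lemma derive1_plateau_eq0 n a c x :
  a <= c -> x \notin `[a, c + n.+1%:R^-1] -> derive1 (plateau n a c) x = 0.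
Proof.
move=> ac xn; rewrite derive1_plateau !scaled_step_derive1_eq0 ?subrr//.
- by apply: contra xn; rewrite !in_itv/= => /andP[cx ->]; rewrite (le_trans ac).
- apply: contra xn; rewrite !in_itv/= => /andP[-> xa]; rewrite (le_trans xa)//.
  by rewrite lerD2r.
Qed.

Lemma plateau_cvg a c x : a <= c -> plateau n a c x @[n --> \oo] --> ((\1_`]a, c] x)%R : R).
Proof.
move=> ac; rewrite (_ : \1__ x = (a < x)%R%:R - (c < x)%R%:R :> R).
  by apply: cvgB; exact: scaled_step_cvg.
rewrite indicE mem_setE in_itv/= leNgt.
have [ax|xa] := ltP a x; have [cx|xc] := ltP c x; rewrite ?subrr ?subr0//=.
by move: (le_lt_trans ac cx); rewrite ltNge xa.
Qed.

Lemma test_function_plateau n a c (I : set R) : a <= c ->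
  `[a, c + n.+1%:R^-1] `<=` I -> test_function I (plateau n a c).
Proof.
move=> ac acI; have sub : closure [set x | plateau n a c x != 0] `<=` `[a, c + n.+1%:R^-1].
  rewrite [X in _ `<=` X](closure_id _).1; last exact: itv_closed.
  by apply: closure_subset => x /=; apply: contra_neqT => /plateau_eq0; exact.
split; first by apply: Ck_smooth => m; exact: Ck_plateau.
- apply: subclosed_compact sub; [exact: closed_closure|exact: segment_compact].
- exact: subset_trans acI.
Qed.

(** As [n] grows, the derivatives of the plateaux tend to the Dirac mass at [a] minus the one at
    [c], while the plateaux tend boundedly to the indicator of []a, c]]. The identity is assumed for
    plateaux only, so that it can also be supplied by slices of planar identities; [r] is the room
    for their supports, which overshoot [c]. *)
Lemma weak_derivative_plateau f g (D : set R) a c r : continuous f -> a <= c -> 0 < r ->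
  `[a, c + r] `<=` D -> mu.-integrable `[a, c + r] (EFin \o g) ->
  (forall n, n.+1%:R^-1 <= r ->
    \int[mu]_(x in D) (f x * derive1 (plateau n a c) x) =
    - \int[mu]_(x in D) (g x * plateau n a c x)) ->
  f c - f a = \int[mu]_(x in `]a, c]) g x.
Proof.
move=> cf ac r0 acD ig fg.
have cr : c < c + r by rewrite ltrDl.
have H1 : \int[mu]_(x in D) (f x * derive1 (plateau n a c) x) @[n --> \oo] --> f a - f c.
  apply: cvg_trans; last exact: (cvgB (Rintegral_scaled_step_cvg cf (lexx a) (le_lt_trans ac cr))
               (Rintegral_scaled_step_cvg cf ac cr)).
  apply: near_eq_cvg; near=> n.
  have nr : n.+1%:R^-1 <= r.
    by apply/ltW; near: n; exact: (near_infty_natSinv_lt (PosNum r0)).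
  rewrite (Rintegral_subset_eq0 mu (K := `[a, c + r]))//; last first.
    move=> x xK; rewrite derive1_plateau_eq0 ?mulr0//; apply: contra_notN xK => /=.
    by rewrite !in_itv/= => /andP[-> xc]; rewrite (le_trans xc)// lerD2l.
  rewrite fctE -RintegralB//; last 2 first.
  - by apply: integrable_continuous => x; apply: cvgM; [exact: cf|exact: scaled_step_derive1_continuous].
  - by apply: integrable_continuous => x; apply: cvgM; [exact: cf|exact: scaled_step_derive1_continuous].
  by apply: eq_Rintegral => x _; rewrite derive1_plateau mulrBr.
have H2 : \int[mu]_(x in D) (g x * plateau n a c x) @[n --> \oo] --> \int[mu]_(x in `]a, c]) g x.
  have mg : measurable_fun `[a, c + r] g by apply/measurable_EFinP; exact: measurable_int ig.
  have [|||||_ +] := @Rintegral_dominated_convergence _ _ _ mu `[a, c + r]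
    (fun n x => g x * plateau n a c x) (fun x => g x * \1_`]a, c] x) (fun x => `|g x|).
  - by [].
  - move=> n; apply: measurable_funM => //.
    by apply: measurable_funTS; apply: continuous_measurable_fun; exact: plateau_continuous.
  - by move=> x _; apply: cvgM; [exact: cvg_cst|exact: plateau_cvg].
  - exact: integrable_norm.
  - by move=> n x _; rewrite normrM -[leRHS]mulr1 ler_wpM2l// plateau_le1.
  rewrite (Rintegral_subset_eq0 mu (K := `]a, c])); last 2 first.
  - by move=> x /=; rewrite !in_itv/= => /andP[ax xc]; rewrite ltW//= (le_trans xc)// ltW.
  - by move=> x xn; rewrite indicE memNset ?mulr0.
  rewrite (@eq_Rintegral _ _ _ mu `]a, c]%classic g); last by move=> x xac; rewrite indicE xac mulr1.
  apply: cvg_trans; apply: near_eq_cvg; near=> n.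
  have nr : n.+1%:R^-1 <= r.
    by apply/ltW; near: n; exact: (near_infty_natSinv_lt (PosNum r0)).
  rewrite [RHS](Rintegral_subset_eq0 mu (K := `[a, c + r]))//.
  move=> x xK; rewrite plateau_eq0 ?mulr0//; apply: contra_notN xK => /=.
  by rewrite !in_itv/= => /andP[-> xc]; rewrite (le_trans xc)// lerD2l.
have H3 : \int[mu]_(x in D) (f x * derive1 (plateau n a c) x) @[n --> \oo] -->
    - \int[mu]_(x in `]a, c]) g x.
  move/cvgN : H2; apply: cvg_trans; apply: near_eq_cvg; near=> n.
  by rewrite fg//; apply/ltW; near: n; exact: (near_infty_natSinv_lt (PosNum r0)).
have := cvg_unique _ H1 H3; move=> /(_ (@Rhausdorff R)) E.
by rewrite -[RHS]opprK -E opprB.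
Unshelve. all: by end_near. Qed.

End fundamental_lemma.

(* Additivity of [m] makes the errors on a partition sum up to
   [eta * (m b - m a)], with [eta] arbitrary. *)
Lemma nondecreasing_of_local (R : realType) (K m : R -> R) (a b : R) : a <= b ->
  (forall eta, 0 < eta -> exists2 delta, 0 < delta &
    forall x y, a <= x -> x <= y -> y <= b -> y - x < delta ->
      - (eta * (m y - m x)) <= K y - K x) ->
  K a <= K b.
Proof.
move=> ab H.
have {}H eta : 0 < eta -> - (eta * (m b - m a)) <= K b - K a.
  move=> eta0; have [delta delta0 {}H] := H _ eta0.
  have [N bN] : exists N : nat, (b - a) / N.+1%:R < delta.
    exists (Num.truncn ((b - a) / delta)); rewrite ltr_pdivrMr ?ltr0n// mulrC.
    by rewrite -ltr_pdivrMr//; exact: truncnS_gt.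
  have N0 : 0 < N.+1%:R :> R by rewrite ltr0n.
  pose h := (b - a) / N.+1%:R; have h0 : 0 <= h by rewrite divr_ge0 ?subr_ge0.
  have hN : h * N.+1%:R = b - a by rewrite divfK// gt_eqF.
  suff P i : (i <= N.+1)%N ->
      - (eta * (m (a + h * i%:R) - m a)) <= K (a + h * i%:R) - K a.
    by have := P N.+1 (leqnn _); rewrite hN subrKC.
  elim: i => [_|i IH iN]; first by rewrite mulr0 addr0 !subrr mulr0 oppr0.
  have {}IH := IH (ltnW iN).
  have hi : 0 <= h * i%:R by rewrite mulr_ge0.
  have hi1 : h * i.+1%:R = h * i%:R + h by rewrite -natr1 mulrDr mulr1.
  have hiN : h * i.+1%:R <= b - a by rewrite -hN ler_wpM2l ?ler_nat.
  have := H (a + h * i%:R) (a + h * i.+1%:R).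
  rewrite lerDl hi lerD2l hi1 lerDl h0 -hi1 -lerBrDl hiN.
  have -> : a + h * i.+1%:R - (a + h * i%:R) = h by rewrite hi1; ring.
  by move=> /(_ isT isT isT bN); lra.
have [//|Kba] := leP (K a) (K b).
set D := K a - K b; have D0 : 0 < D by rewrite subr_gt0.
set c := `|m b - m a| + 1; have c0 : 0 < c by rewrite ltr_wpDl.
have := H (D / (2 * c)); rewrite divr_gt0 ?mulr_gt0// => /(_ isT).
have : D / (2 * c) * (m b - m a) <= D / 2.
  rewrite -[leRHS]mulr1 invfM mulrA -!mulrA ler_pM2l// ler_pM2l ?invr_gt0//.
  by rewrite mulrC ler_pdivrMr// mul1r /c (le_trans (ler_norm _))// lerDl.
by rewrite -/D; rewrite /D in D0 *; lra.
Qed.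

(** Heine's theorem by the covering form of compactness. Continuity on the whole space lets the
    second point lie outside [A]. *)
Lemma uniform_continuity_compact (R : realType) (T : pseudoMetricType R) (A : set T)
    (f : T -> R) (eta : R) : compact A -> continuous f -> 0 < eta ->
  exists2 delta, 0 < delta & forall x y, A x -> ball x delta y -> `|f x - f y| <= eta.
Proof.
move=> /compact_near_coveringP cA cf eta0.
have := cA R (0^'+) (fun d x => forall y, ball x d y -> `|f x - f y| <= eta) _.
move=> /(_ _)[].
  move=> x Ax; have eta20 : 0 < eta / 2 by rewrite divr_gt0.
  have /cvgrPdist_le /(_ _ eta20) /nbhs_ballP [r /= r0 fr] := cf x.
  exists (ball x (r / 2), [set d | d < r / 2]) => /=.
    split; first by apply: nbhsx_ballx; rewrite divr_gt0.
    by apply: nbhs_right_lt; rewrite divr_gt0.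
  move=> [x' d] /= [xx' dr] y x'y.
  have h1 := fr x' (le_ball _ xx').
  have h2 := fr y _; rewrite (splitr eta).
  rewrite (_ : f x' - f y = (f x - f y) - (f x - f x')); last by ring.
  rewrite (le_trans (ler_normB _ _))// lerD//.
    apply: h2; rewrite (splitr r); apply: (ball_triangle xx').
    by apply: le_ball x'y; exact: ltW.
  by apply: h1; lra.
move=> d /= d0 Hd; exists (d / 2); first by rewrite divr_gt0.
move=> x y Ax xy; apply: (Hd (d / 2)) => //=.
- by rewrite /ball/= sub0r normrN gtr0_norm ?divr_gt0//; lra.
- by rewrite divr_gt0.
Qed.

Section real_integrable.
Context d (T : measurableType d) (R : realType) (nu : {measure set T -> \bar R}).
Implicit Types (D : set T) (f g : T -> R).

Lemma integrable_realD D f g : nu.-integrable D (EFin \o f) -> nu.-integrable D (EFin \o g) -> measurable D ->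
  nu.-integrable D (EFin \o (fun x => f x + g x)).
Proof. by move=> fi gi mD; exact: (integrableD mD fi gi). Qed.

Lemma integrable_realB D f g : nu.-integrable D (EFin \o f) -> nu.-integrable D (EFin \o g) -> measurable D ->
  nu.-integrable D (EFin \o (fun x => f x - g x)).
Proof. by move=> fi gi mD; exact: (integrableB mD fi gi). Qed.

Lemma integrable_realZl D (c : R) f : nu.-integrable D (EFin \o f) -> measurable D ->
  nu.-integrable D (EFin \o (fun x => c * f x)).
Proof. by move=> fi mD; exact: (integrableZl mD c fi). Qed.

Lemma integrable_real_norm D f : nu.-integrable D (EFin \o f) -> measurable D ->
  nu.-integrable D (EFin \o (fun x => `|f x|)).
Proof. by move=> ? _; exact: integrable_norm. Qed.

End real_integrable.

(** * Absolutely continuous functions and integration by parts *)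

Section absolutely_continuous.
Variable R : realType.
Notation mu := (@lebesgue_measure R).
Implicit Types (f g p w : R -> R) (a b x y : R).

(** The primitive of [g] extended by zero is locally constant on []a, b[], so its derivative is 0
    there; by Lebesgue differentiation this derivative is [g] almost everywhere. *)
Lemma ae_eq0_of_Rintegral g a b : mu.-integrable `]a, b[ (EFin \o g) ->
  (forall x y, a < x -> x <= y -> y < b -> \int[mu]_(t in `]x, y]) g t = 0) ->
  {ae mu, forall x, x \in `]a, b[ -> g x = 0}.
Proof.
move=> ig g0; pose h := g \_ `]a, b[.
have ih : mu.-integrable setT (EFin \o h).
  by rewrite /h -restrict_EFin; move: ig => /integrable_mkcond; apply.
have := @FTC1Ny R h; move=> /(_ _ _)[].
- by move=> y; apply: integrableS ih.
- exact: integrable_locally_restrict.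
move=> N [mN N0 sub]; exists N; split=> // x /= /not_implyP[xab gx]; apply: sub => /= -[_].
rewrite derive1E => E; apply: gx.
have hx : h x = g x by rewrite /h patchE mem_set.
rewrite -hx -E.
rewrite (@near_eq_derive _ _ _ _ (cst (\int[mu]_(t in `]-oo, x]) h t))) ?derive_cst//.
move: xab; rewrite in_itv/= => /andP[ax xb].
have inc y z : a < y -> y <= z -> z < b ->
   \int[mu]_(t in `]-oo, z]) h t = \int[mu]_(t in `]-oo, y]) h t.
  move=> ay yz zb; apply/eqP; rewrite -subr_eq0.
  rewrite Rintegral_itvB//; last by apply: integrableS ih.
  rewrite -(g0 y z)//; apply/eqP; apply: eq_Rintegral => t.
  rewrite inE/= in_itv/= => /andP[yt tz]; rewrite /h patchE mem_set//=.
  by rewrite in_itv/= (lt_trans ay)//= (le_lt_trans tz).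
near=> y; have [xy|yx] := leP x y.
- by apply: inc => //; near: y; exact: lt_nbhsl.
- by apply/esym; apply: inc => //; last exact: ltW; near: y; exact: lt_nbhsr.
Unshelve. all: by end_near. Qed.

Lemma Rintegral_oc_split f a b x y : mu.-integrable `]a, b] (EFin \o f) ->
  a <= x -> x <= y -> y <= b ->
  \int[mu]_(t in `]a, y]) f t - \int[mu]_(t in `]a, x]) f t = \int[mu]_(t in `]x, y]) f t.
Proof.
move=> fi ax xy yb; rewrite Rintegral_itvB ?bnd_simp//.
by apply: integrableS fi => //; apply: subset_itvl; rewrite bnd_simp.
Qed.

Lemma integrable_oc_sub f a b x y : mu.-integrable `]a, b] (EFin \o f) ->
  a <= x -> y <= b -> mu.-integrable `]x, y] (EFin \o f).
Proof.
move=> fi ax yb; apply: integrableS fi => //.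
by apply: subset_itv; rewrite bnd_simp.
Qed.

Lemma integrable_continuousMl f g a b : continuous f -> mu.-integrable `]a, b] (EFin \o g) ->
  mu.-integrable `]a, b] (EFin \o (fun x => f x * g x)).
Proof.
move=> cf ig.
have [M [_ fM]] : bounded_set (f @` `[a, b]).
  apply: compact_bounded; apply: continuous_compact; last exact: segment_compact.
  exact: continuous_subspaceT.
have mf : measurable_fun `]a, b] f.
  by apply: measurable_funTS; exact: continuous_measurable_fun.
rewrite (_ : EFin \o _ = (EFin \o f) \* (EFin \o g))%E; last first.
  by apply/funext => x /=; rewrite EFinM.
apply: integrableMr => //; exists M; split; first exact: num_real.
move=> N MN x /= xab; apply: fM => //; exists x => //.
by move: xab; rewrite /= !in_itv/= => /andP[/ltW -> ->].
Qed.

(** Put [K x = p x * w x - \int_a^x h]. The discrete product rule [p y * w y - p x * w x = p y * (w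
    y - w x) + w x * (p y - p x)] writes an increment of [K] as the integral of
    [(p y - p t) * w' t + (w x - w t) * p' t]. On short intervals uniform continuity bounds it by
    [eta] times the increment of the primitive of [|w'| + |p'|], so both [K] and [- K] are
    nondecreasing. *)
Lemma Rintegration_by_parts_ac p p' w w' a b : a <= b ->
  continuous p -> continuous w ->
  mu.-integrable `]a, b] (EFin \o p') -> mu.-integrable `]a, b] (EFin \o w') ->
  (forall x y, a <= x -> x <= y -> y <= b -> p y - p x = \int[mu]_(t in `]x, y]) p' t) ->
  (forall x y, a <= x -> x <= y -> y <= b -> w y - w x = \int[mu]_(t in `]x, y]) w' t) ->
  p b * w b - p a * w a = \int[mu]_(t in `]a, b]) (p t * w' t + w t * p' t).
Proof.
move=> ab cp cw ip iw pE wE.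
pose h t := p t * w' t + w t * p' t; pose l t : R := `|w' t| + `|p' t|.
have ipw : mu.-integrable `]a, b] (EFin \o (fun t => p t * w' t)).
  exact: integrable_continuousMl.
have iwp : mu.-integrable `]a, b] (EFin \o (fun t => w t * p' t)).
  exact: integrable_continuousMl.
have ih : mu.-integrable `]a, b] (EFin \o h).
  exact: integrable_realD.
have il : mu.-integrable `]a, b] (EFin \o l).
  by apply: integrable_realD => //; exact: integrable_real_norm.
pose K x := p x * w x - \int[mu]_(t in `]a, x]) h t.
pose m x := \int[mu]_(t in `]a, x]) l t.
have loc eta : 0 < eta -> exists2 delta, 0 < delta &
    forall x y, a <= x -> x <= y -> y <= b -> y - x < delta ->
      `|K y - K x| <= eta * (m y - m x).
  move=> eta0.
  have [d1 d10 H1] := @uniform_continuity_compact R R `[a, b] p eta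
     (@segment_compact _ _ _) cp eta0.
  have [d2 d20 H2] := @uniform_continuity_compact R R `[a, b] w eta
     (@segment_compact _ _ _) cw eta0.
  exists (Num.min d1 d2); first by rewrite lt_min d10 d20.
  move=> x y ax xy yb; rewrite lt_min => /andP[xy1 xy2].
  have ipxy := integrable_oc_sub ip ax yb; have iwxy := integrable_oc_sub iw ax yb.
  have ihxy := integrable_oc_sub ih ax yb; have ilxy := integrable_oc_sub il ax yb.
  have i1 := integrable_realZl (p y) iwxy (measurable_itv _).
  have i2 := integrable_realZl (w x) ipxy (measurable_itv _).
  have i12 := integrable_realD i1 i2 (measurable_itv _).
  have i3 := integrable_realB i12 ihxy (measurable_itv _).
  have -> : K y - K x = \int[mu]_(t in `]x, y]) ((p y * w' t + w x * p' t) - h t).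
    rewrite RintegralB// RintegralD// !RintegralZl// -pE// -wE//.
    rewrite -(Rintegral_oc_split ih ax xy yb) /K; ring.
  rewrite /m (Rintegral_oc_split il)// -RintegralZl//.
  apply: le_trans (le_normr_Rintegral _ _) _ => //.
  apply: le_Rintegral => //; first exact: integrable_real_norm.
    exact: integrable_realZl.
  move=> t /=; rewrite in_itv/= => /andP[xt ty]; rewrite /h /l.
  have -> : p y * w' t + w x * p' t - (p t * w' t + w t * p' t) =
    (p y - p t) * w' t + (w x - w t) * p' t by ring.
  rewrite mulrDr (le_trans (ler_normD _ _))// !normrM lerD// ler_wpM2r//.
    apply: H1; first by rewrite /= in_itv/= yb (le_trans ax).
    rewrite /ball/= ger0_norm ?subr_ge0// (le_lt_trans _ xy1)// lerD2l lerN2; exact: ltW.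
  apply: H2; first by rewrite /= in_itv/= ax (le_trans xy).
  by rewrite /ball/= distrC ger0_norm ?subr_ge0 ?(ltW xt)// (le_lt_trans _ xy2)// lerD2r.
have E1 : K a <= K b.
  apply: (@nondecreasing_of_local _ _ m) => // eta /loc[d d0 H]; exists d => // x y ax xy yb xyd.
  by have := H x y ax xy yb xyd; rewrite ler_norml => /andP[].
have E2 : - K a <= - K b.
  apply: (@nondecreasing_of_local _ (fun x => - K x) m) => // eta /loc[d d0 H].
  exists d => // x y ax xy yb xyd.
  by have := H x y ax xy yb xyd; rewrite ler_norml -opprD lerN2 => /andP[].
have : K a = K b by apply/eqP; rewrite eq_le E1 -lerN2.
rewrite /K set_itvoc0 Rintegral_set0 subr0 => ->.
by rewrite opprB addrC subrK.
Qed.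

End absolutely_continuous.

(** * Slices of weak derivatives in the plane *)

Section plane_measurability.
Variable R : realType.
Notation RR := (measurableTypeR R * measurableTypeR R)%type.

(** Measurability here is with respect to the product sigma-algebra, so an open set is written as
    the countable union of the rational boxes it contains. Boxes that stick out are replaced by the
    empty set, so that the union runs over all rational quadruples. *)
Lemma open_measurable_plane (A : set (R * R)) : open A -> measurable (A : set RR).
Proof.
move=> oA.
pose box (q : rat * rat * (rat * rat)) : set RR :=
  `]ratr q.1.1, ratr q.1.2[%classic `*` `]ratr q.2.1, ratr q.2.2[%classic.
pose B q : set RR := if `[< box q `<=` A >] then box q else set0.
have -> : (A : set RR) = \bigcup_q B q.
  apply/seteqP; split => [[x y] Axy|x [q _]]; last first.
    by rewrite /B; case: asboolP => // bA; exact: bA.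
  have /nbhs_ballP [e /= e0 eA] : nbhs ((x, y) : R * R) A by exact: open_nbhs_nbhs.
  have /rat_in_itvoo [a /itvP ha] : x - e < x by rewrite ltrBlDr ltrDl.
  have /rat_in_itvoo [b /itvP hb] : x < x + e by rewrite ltrDl.
  have /rat_in_itvoo [c /itvP hc] : y - e < y by rewrite ltrBlDr ltrDl.
  have /rat_in_itvoo [d /itvP hd] : y < y + e by rewrite ltrDl.
  exists (a, b, (c, d)) => //; rewrite /B ifT.
    by split; rewrite /= in_itv/= ?ha ?hb ?hc ?hd.
  apply/asboolP => -[u v] [/= ]; rewrite !in_itv/= => /andP[au ub] /andP[cv vd].
  have near (p q : R) : p - e < q -> q < p + e -> ball p e q.
    by move=> h1 h2; rewrite /ball/= ltr_norml; lra.
  apply: eA; split => /=; apply: near.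
  - by rewrite (lt_trans _ au)// ha.
  - by rewrite (lt_trans ub)// hb.
  - by rewrite (lt_trans _ cv)// hc.
  - by rewrite (lt_trans vd)// hd.
apply: countable_bigcupT_measurable; first exact: countableP.
move=> q; rewrite /B; case: ifP => // _.
by apply: measurableX; exact: measurable_itv.
Qed.

Lemma continuous_measurable_fun_plane (f : R * R -> R) : continuous f ->
  measurable_fun setT (f : RR -> R).
Proof.
move=> /continuousP cf; apply: (measurability _ (RGenOpens.measurableE R)).
move=> _ [_ [a [b ->] <-]]; rewrite setTI; apply: open_measurable_plane.
exact/cf/interval_open.
Qed.

Lemma mu2_setX (A B : set (measurableTypeR R)) : measurable A -> measurable B ->
  (mu2 R (A `*` B) = @lebesgue_measure R A * @lebesgue_measure R B)%E.
Proof. by move=> mA mB; exact: product_measure1E. Qed.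

End plane_measurability.

Section Rintegral_Fubini.
Variable R : realType.
Notation mu := (@lebesgue_measure R).
Notation RR := (measurableTypeR R * measurableTypeR R)%type.
Variable F : RR -> R.
Hypothesis iF : (mu2 R).-integrable setT (EFin \o F).

Lemma ae_integrable_slice1 :
  {ae mu, forall t, mu.-integrable setT (EFin \o (fun z => F (t, z)))}.
Proof. exact: ae_integrable1 iF. Qed.

Lemma ae_integrable_slice2 :
  {ae mu, forall z, mu.-integrable setT (EFin \o (fun t => F (t, z)))}.
Proof. exact: ae_integrable2 iF. Qed.

Lemma integrable_Rintegral_slice1 :
  mu.-integrable setT (EFin \o (fun t => \int[mu]_z F (t, z))).
Proof.
have iI := integrable_fubini_F iF.
apply: le_integrable iI => //.
- apply/measurable_EFinP; apply: measurableT_comp => //.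
  exact: (measurable_fubini_F iF).
(* Where the slice integral is infinite, [fine] returns 0, so the domination holds at every [t]. *)
- move=> t _ /=; rewrite /Rintegral /fubini_F/=.
  by case: (\int[mu]_z (F (t, z))%:E)%E => [r| |] //=; rewrite ?normr0 ?leey.
Qed.

Lemma Rintegral_slice1 : \int[mu]_t \int[mu]_z F (t, z) = \int[mu2 R]_x F x.
Proof.
rewrite {1}/Rintegral [RHS]/Rintegral -(integral12_prod_meas1 iF); congr fine.
apply: ae_eq_integral => //.
- by case/integrableP : integrable_Rintegral_slice1.
- by apply: measurable_int; exact: (integrable_fubini_F iF).
apply: filterS ae_integrable_slice1 => t it _.
by rewrite /Rintegral fineK//; exact: integrable_fin_num.
Qed.

Lemma integrable_Rintegral_slice2 :
  mu.-integrable setT (EFin \o (fun z => \int[mu]_t F (t, z))).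
Proof.
have mG := measurable_fubini_G iF.
have iI : mu.-integrable setT (fubini_G mu (EFin \o F)).
  have mF : measurable_fun setT (EFin \o F) by exact: measurable_int iF.
  apply/integrableP; split => //.
  apply: le_lt_trans ((@integrable21ltyP _ _ _ _ _ mu mu _ mF).1 iF).
  have mn : measurable_fun setT (fun y => \int[mu]_x `|(EFin \o F) (x, y)|)%E.
    have mab : measurable_fun setT (abse \o (EFin \o F)) by exact: measurableT_comp.
    by apply: (@measurable_fun_fubini_tonelli_G _ _ _ _ _ mu (abse \o (EFin \o F))) => // x;
      exact: abse_ge0.
  apply: ge0_le_integral => //; first exact: measurableT_comp.
  by move=> y _; apply: le_abse_integral => //; exact: measurableT_comp.
apply: le_integrable iI => //.
- apply/measurable_EFinP; apply: measurableT_comp => //.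
- move=> t _ /=; rewrite /Rintegral /fubini_G/=.
  by case: (\int[mu]_z (F (z, t))%:E)%E => [r| |] //=; rewrite ?normr0 ?leey.
Qed.

Lemma Rintegral_slice2 : \int[mu]_z \int[mu]_t F (t, z) = \int[mu2 R]_x F x.
Proof.
rewrite {1}/Rintegral [RHS]/Rintegral -(integral21_prod_meas1 iF); congr fine.
apply: ae_eq_integral => //.
- by case/integrableP : integrable_Rintegral_slice2.
- exact: (measurable_fubini_G iF).
apply: filterS ae_integrable_slice2 => t it _.
by rewrite /Rintegral fineK//; exact: integrable_fin_num.
Qed.

End Rintegral_Fubini.

Section tensor_test_functions.
Variable R : realType.
Implicit Types (m n : nat) (p q a c : R) (x : R * R).

(** These products are the only planar test functions at which a weak identity is evaluated: one
    factor localises the lines, the other becomes the one-variable test function on each of them. *)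
Definition tensor m p q n a c x : R := plateau m p q x.1 * plateau n a c x.2.

Lemma Ck_tensor k m p q n a c : Ck k (tensor m p q n a c).
Proof. by apply: CkM; [apply: Ck_fst|apply: Ck_snd]; exact: Ck_plateau. Qed.

Lemma test_function_tensor m p q n a c (Omega : set (R * R)) :
  p <= q -> a <= c ->
  `[p, q + m.+1%:R^-1] `*` `[a, c + n.+1%:R^-1] `<=` Omega ->
  test_function Omega (tensor m p q n a c).
Proof.
move=> tt ac sub.
pose K : set (R * R) := `[p, q + m.+1%:R^-1] `*` `[a, c + n.+1%:R^-1].
have cK : compact K by apply: compact_setX; exact: segment_compact.
have sK : closure [set x | tensor m p q n a c x != 0] `<=` K.
  rewrite [X in _ `<=` X](closure_id K).1; last first.
    by apply: compact_closed => //; exact: norm_hausdorff.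
  apply: closure_subset => x /=; apply: contra_neqP => xK; rewrite /tensor.
  have [x1|x1] := boolP (x.1 \in `[p, q + m.+1%:R^-1]); last first.
    by rewrite plateau_eq0// mul0r.
  rewrite [X in _ * X]plateau_eq0 ?mulr0//; apply/negP => x2; exact: xK.
split; first by apply: Ck_smooth => k; exact: Ck_tensor.
- by apply: subclosed_compact sK; [exact: closed_closure|exact: cK].
- exact: subset_trans sub.
Qed.

Lemma derive_fst (f : R -> R) x (v : R * R) :
  'D_v (fun y : R * R => f y.1) x = 'D_(v.1) f x.1.
Proof. by []. Qed.

Lemma derive_snd (f : R -> R) x (v : R * R) :
  'D_v (fun y : R * R => f y.2) x = 'D_(v.2) f x.2.
Proof. by []. Qed.

Lemma derive_tensor m p q n a c x (v : R * R) :
  'D_v (tensor m p q n a c) x =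
    'D_(v.1) (plateau m p q) x.1 * plateau n a c x.2 +
    plateau m p q x.1 * 'D_(v.2) (plateau n a c) x.2.
Proof.
pose F := fun x : R * R => plateau m p q x.1.
pose G := fun x : R * R => plateau n a c x.2.
have dF : derivable F x v by have [_ H _] := Ck_fst (Ck_plateau 1 m p q); exact: (H x v).
have dG : derivable G x v by have [_ H _] := Ck_snd (Ck_plateau 1 n a c); exact: (H x v).
rewrite -[LHS]/('D_v (F * G) x).
rewrite (deriveM dF dG) derive_fst derive_snd addrC; congr (_ + _).
exact: mulrC.
Qed.

Lemma derive_tensor1 m p q n a c x :
  'D_(1, 0) (tensor m p q n a c) x = derive1 (plateau m p q) x.1 * plateau n a c x.2.
Proof. by rewrite derive_tensor/= derive0 mulr0 addr0 derive1E. Qed.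

Lemma derive_tensor2 m p q n a c x :
  'D_(0, 1) (tensor m p q n a c) x = plateau m p q x.1 * derive1 (plateau n a c) x.2.
Proof. by rewrite derive_tensor/= derive0 mul0r add0r derive1E. Qed.

End tensor_test_functions.

Section slices.
Variable R : realType.
Notation mu := (@lebesgue_measure R).
Notation RR := (measurableTypeR R * measurableTypeR R)%type.

Lemma integrable_bounded_mul d (T : measurableType d) (nu : {measure set T -> \bar R})
    (D : set T) (f g : T -> R) (M : R) : measurable D ->
  nu.-integrable D (EFin \o f) -> measurable_fun D g -> (forall x, D x -> `|g x| <= M) ->
  nu.-integrable D (EFin \o (fun x => f x * g x)).
Proof.
move=> mD fi mg gM.
rewrite (_ : EFin \o _ = (EFin \o f) \* (EFin \o g))%E; last first.
  by apply/funext => x /=; rewrite EFinM.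
apply: integrableMl => //; exists M; split; first exact: num_real.
by move=> N MN x /= Dx; rewrite (le_trans (gM x Dx))// ltW.
Qed.

Lemma ae_eq_Rintegral d (T : measurableType d) (nu : {measure set T -> \bar R})
    (D : set T) (f g : T -> R) : measurable D -> measurable_fun D f -> measurable_fun D g ->
  {ae nu, forall x, D x -> f x = g x} -> \int[nu]_(x in D) f x = \int[nu]_(x in D) g x.
Proof.
move=> mD mf mg fg; congr fine; apply: ae_eq_integral => //; try exact/measurable_EFinP.
by apply: filterS fg => x fg Dx; rewrite fg.
Qed.

(** By Fubini, the slice integral as a function of [t] has zero integral against every plateau. This
    says that it is the weak derivative of the zero function, so its integrals over intervals []x,
    y]] vanish by [weak_derivative_plateau] with room [b - y], and [ae_eq0_of_Rintegral] applies. *)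
Lemma ae_slice1_eq0 (F : RR -> R) (a b : R) : (mu2 R).-integrable setT (EFin \o F) ->
  (forall m p q, a < p -> p <= q -> q + m.+1%:R^-1 <= b ->
    \int[mu2 R]_x (F x * plateau m p q x.1) = 0) ->
  {ae mu, forall t, t \in `]a, b[ -> \int[mu]_z F (t, z) = 0}.
Proof.
move=> iF F0; have ik := integrable_Rintegral_slice1 iF.
apply: ae_eq0_of_Rintegral; first exact: integrableS ik.
move=> x y ax xy yb; have yb0 : 0 < b - y by rewrite subr_gt0.
rewrite -(@weak_derivative_plateau R (cst 0) _ setT x y (b - y))//.
- by rewrite subrr.
- exact: cst_continuous.
- exact: integrableS ik.
move=> n nb; under eq_Rintegral do rewrite mul0r.
rewrite Rintegral_cst// mul0r; apply/esym/eqP; rewrite oppr_eq0; apply/eqP.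
rewrite -[RHS](F0 n x y)//; last by rewrite -lerBrDl.
have iFp : (mu2 R).-integrable setT (EFin \o (fun w => F w * plateau n x y w.1)).
  apply: (integrable_bounded_mul (M := 1)) => //; last by move=> w _; exact: plateau_le1.
  apply: (measurableT_comp (continuous_measurable_fun (@plateau_continuous R n x y))).
  exact: measurable_fst.
rewrite -(Rintegral_slice1 iFp)/=.
have ipk : mu.-integrable setT (EFin \o (fun t => (\int[mu]_z F (t, z)) * plateau n x y t)).
  apply: (integrable_bounded_mul (M := 1)) => //; last by move=> w _; exact: plateau_le1.
  exact: (continuous_measurable_fun (@plateau_continuous R n x y)).
apply: ae_eq_Rintegral => //.
- by apply/measurable_EFinP; case/integrableP : ipk.
- by apply/measurable_EFinP; case/integrableP : (integrable_Rintegral_slice1 iFp).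
by apply: filterS (ae_integrable_slice1 iF) => t it _; rewrite RintegralZr.
Qed.

Lemma ae_slice2_eq0 (F : RR -> R) (a b : R) : (mu2 R).-integrable setT (EFin \o F) ->
  (forall m p q, a < p -> p <= q -> q + m.+1%:R^-1 <= b ->
    \int[mu2 R]_x (F x * plateau m p q x.2) = 0) ->
  {ae mu, forall z, z \in `]a, b[ -> \int[mu]_t F (t, z) = 0}.
Proof.
move=> iF F0; have ik := integrable_Rintegral_slice2 iF.
apply: ae_eq0_of_Rintegral; first exact: integrableS ik.
move=> x y ax xy yb; have yb0 : 0 < b - y by rewrite subr_gt0.
rewrite -(@weak_derivative_plateau R (cst 0) _ setT x y (b - y))//.
- by rewrite subrr.
- exact: cst_continuous.
- exact: integrableS ik.
move=> n nb; under eq_Rintegral do rewrite mul0r.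
rewrite Rintegral_cst// mul0r; apply/esym/eqP; rewrite oppr_eq0; apply/eqP.
rewrite -[RHS](F0 n x y)//; last by rewrite -lerBrDl.
have iFp : (mu2 R).-integrable setT (EFin \o (fun w => F w * plateau n x y w.2)).
  apply: (integrable_bounded_mul (M := 1)) => //; last by move=> w _; exact: plateau_le1.
  apply: (measurableT_comp (continuous_measurable_fun (@plateau_continuous R n x y))).
  exact: measurable_snd.
rewrite -(Rintegral_slice2 iFp)/=.
have ipk : mu.-integrable setT (EFin \o (fun z => (\int[mu]_t F (t, z)) * plateau n x y z)).
  apply: (integrable_bounded_mul (M := 1)) => //; last by move=> w _; exact: plateau_le1.
  exact: (continuous_measurable_fun (@plateau_continuous R n x y)).
apply: ae_eq_Rintegral => //.
- by apply/measurable_EFinP; case/integrableP : ipk.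
- by apply/measurable_EFinP; case/integrableP : (integrable_Rintegral_slice2 iFp).
by apply: filterS (ae_integrable_slice2 iF) => z iz _; rewrite RintegralZr.
Qed.

Lemma derive1_plateau_bounded n (a c : R) : a <= c ->
  exists M : R, forall x, `|derive1 (plateau n a c) x| <= M.
Proof.
move=> ac.
have [M [_ fM]] : bounded_set (derive1 (plateau n a c) @` `[a, c + n.+1%:R^-1]).
  apply: compact_bounded; apply: continuous_compact; last exact: segment_compact.
  exact/continuous_subspaceT/derive1_plateau_continuous.
exists (`|M| + 1) => x; have [xac|xac] := boolP (x \in `[a, c + n.+1%:R^-1]).
  by apply: fM; [rewrite (le_lt_trans (ler_norm M))// ltrDl|exists x].
by rewrite derive1_plateau_eq0// normr0 addr_ge0.
Qed.

Lemma integrable_patch_plane (K : set RR) (f : RR -> R) : measurable K ->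
  (mu2 R).-integrable K (EFin \o f) -> (mu2 R).-integrable setT (EFin \o (f \_ K)).
Proof. by move=> mK; rewrite -restrict_EFin => /integrable_mkcond; exact. Qed.

(** For each [n], testing with tensors shows that the slice integral of [F n] vanishes for almost
    every [t]. Only countably many [n] occur, so one null set of times serves for all of them, and
    on a remaining slice these identities are the hypothesis of [weak_derivative_plateau]. The
    representative [w] is quantified after the null set because it is chosen later, slice by
    slice. *)
Lemma ae_slice2_ftc (Omega : set (R * R)) (f g : R * R -> R) (al be a c r : R) :
  weak_derivative2 Omega (0, 1) f g -> a <= c -> 0 < r ->
  `[al, be] `*` `[a, c + r] `<=` Omega ->
  {ae mu, forall t, t \in `]al, be[ ->
    mu.-integrable `[a, c + r] (EFin \o (fun z => g (t, z))) /\
    forall w : R -> R, continuous w ->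
      {ae mu, forall z, z \in `[a, c + r] -> f (t, z) = w z} ->
      w c - w a = \int[mu]_(z in `]a, c]) g (t, z)}.
Proof.
have FF := ae_filter_ringOfSetsType mu.
move=> [locfg wfg] ac r0 KO; pose K : set RR := `[al, be] `*` `[a, c + r].
have mK : measurable K by apply: measurableX; exact: measurable_itv.
have [ifK0 igK0] : (mu2 R).-integrable K (EFin \o f) /\ (mu2 R).-integrable K (EFin \o g).
  by apply: locfg => //; apply: compact_setX; exact: segment_compact.
have ifK := integrable_patch_plane mK ifK0; have igK := integrable_patch_plane mK igK0.
pose F n x := (f \_ K) x * derive1 (plateau n a c) x.2 + (g \_ K) x * plateau n a c x.2.
have m2 (h : R -> R) : continuous h -> measurable_fun setT (fun x : RR => h x.2).
  by move=> ch; exact: (measurableT_comp (continuous_measurable_fun ch) measurable_snd).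
have m1 (h : R -> R) : continuous h -> measurable_fun setT (fun x : RR => h x.1).
  by move=> ch; exact: (measurableT_comp (continuous_measurable_fun ch) measurable_fst).
have i1 n : (mu2 R).-integrable setT (EFin \o (fun x => (f \_ K) x * derive1 (plateau n a c) x.2)).
  have [M HM] := derive1_plateau_bounded n ac.
  by apply: (integrable_bounded_mul (M := M)) => //; exact: m2 (@derive1_plateau_continuous R n a c).
have i2 n : (mu2 R).-integrable setT (EFin \o (fun x => (g \_ K) x * plateau n a c x.2)).
  apply: (integrable_bounded_mul (M := 1)) => //; first exact: m2 (@plateau_continuous R n a c).
  by move=> x _; exact: plateau_le1.
have iF n : (mu2 R).-integrable setT (EFin \o F n) by exact: integrable_realD (i1 n) (i2 n) _.
have F0 n : n.+1%:R^-1 <= r -> {ae mu, forall t, t \in `]al, be[ -> \int[mu]_z F n (t, z) = 0}.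
  move=> nr; apply: ae_slice1_eq0 => // m p q alp pq qb.
  have sub : `[p, q + m.+1%:R^-1] `*` `[a, c + n.+1%:R^-1] `<=` K.
    move=> [t z] [/=]; rewrite !in_itv/= => /andP[pt tq] /andP[az zc]; split; rewrite /= in_itv/=.
      by rewrite (le_trans (ltW alp))// (le_trans tq).
    by rewrite az (le_trans zc)// lerD2l.
  have tst := test_function_tensor pq ac (subset_trans sub KO).
  (* Off [K] one of the two factors vanishes, so integrals over [Omega] may be replaced by integrals
     over the plane of functions cut off to [K], which are integrable there. *)
  have out x : ~ K x -> (plateau m p q x.1 = 0) \/
      (plateau n a c x.2 = 0 /\ derive1 (plateau n a c) x.2 = 0).
    move=> nK; have [x1|x1] := boolP (x.1 \in `[p, q + m.+1%:R^-1]).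
      have x2 : x.2 \notin `[a, c + n.+1%:R^-1].
        by apply/negP => x2; apply/nK/sub.
      by right; rewrite plateau_eq0// derive1_plateau_eq0.
    by left; rewrite plateau_eq0.
  have patch (h k : R * R -> R) : (forall x, ~ K x -> k x = 0) ->
      \int[mu2 R]_(x in Omega) (h x * k x) = \int[mu2 R]_x ((h \_ K) x * k x).
    move=> k0; rewrite (Rintegral_subset_eq0 (mu2 R) KO) => [|x nK]; last by rewrite k0// mulr0.
    rewrite Rintegral_mkcond; apply: eq_Rintegral => x _; rewrite !patchE.
    by case: ifP => // _; rewrite mul0r.
  have := wfg _ tst.
  under eq_Rintegral do rewrite derive_tensor2.
  rewrite patch; last by move=> x /out[->|[_ ->]]; rewrite ?mul0r ?mulr0.
  rewrite patch; last by move=> x /out[|[]]; rewrite /tensor => ->; rewrite ?mul0r ?mulr0.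
  move=> E.
  have mp : measurable_fun setT (fun x : RR => plateau m p q x.1).
    exact: m1 (@plateau_continuous R m p q).
  have j1 : (mu2 R).-integrable setT
      (EFin \o (fun x => (f \_ K) x * derive1 (plateau n a c) x.2 * plateau m p q x.1)).
    by apply: (integrable_bounded_mul (M := 1)) => // x _; exact: plateau_le1.
  have j2 : (mu2 R).-integrable setT
      (EFin \o (fun x => (g \_ K) x * plateau n a c x.2 * plateau m p q x.1)).
    by apply: (integrable_bounded_mul (M := 1)) => // x _; exact: plateau_le1.
  rewrite /F; under eq_Rintegral do rewrite mulrDl.
  rewrite RintegralD//.
  under [X in X + _]eq_Rintegral do rewrite mulrAC -mulrA.
  under [X in _ + X]eq_Rintegral do rewrite mulrAC -mulrA.
  by rewrite E /tensor addNr.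
have {}F0 : {ae mu, forall t n, t \in `]al, be[ -> n.+1%:R^-1 <= r -> \int[mu]_z F n (t, z) = 0}.
  apply: ae_foralln => n; have [nr|nr] := leP n.+1%:R^-1 r.
    by apply: filterS (F0 n nr) => t H tab _; exact: H.
  by apply: aeW => t _.
have sliceE (h : R * R -> R) t : t \in `]al, be[ ->
    (fun z => (h \_ K) (t, z)) = (fun z => h (t, z)) \_ `[a, c + r].
  move=> tab; apply/funext => z; rewrite !patchE; congr (if _ then _ else _).
  have tc : `[al, be]%classic t by apply: subset_itv_oo_cc.
  apply/idP/idP => [/set_mem[_ H]|/set_mem H]; exact: mem_set.
have slice (h : R * R -> R) t : t \in `]al, be[ ->
    mu.-integrable setT (EFin \o (fun z => (h \_ K) (t, z))) ->
    mu.-integrable `[a, c + r] (EFin \o (fun z => h (t, z))).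
  move=> tab; rewrite (sliceE _ _ tab) => ih; apply/integrable_mkcond => //.
  by rewrite restrict_EFin.
apply: filterS3 F0 (ae_integrable_slice1 ifK) (ae_integrable_slice1 igK).
move=> t F0 /slice sf /slice sg tab; have {}sf := sf tab; have {}sg := sg tab.
split => // w cw fw.
apply: (@weak_derivative_plateau R w _ `[a, c + r] a c r) => // n nr.
have [M HM] := derive1_plateau_bounded n ac.
have mdp : measurable_fun `[a, c + r] (derive1 (plateau n a c)).
  by apply: measurable_funTS; exact: continuous_measurable_fun (@derive1_plateau_continuous R n a c).
have mpl : measurable_fun `[a, c + r] (plateau n a c).
  by apply: measurable_funTS; exact: continuous_measurable_fun (@plateau_continuous R n a c).
have k1 : mu.-integrable `[a, c + r] (EFin \o (fun z => f (t, z) * derive1 (plateau n a c) z)).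
  exact: (integrable_bounded_mul (M := M)).
have k2 : mu.-integrable `[a, c + r] (EFin \o (fun z => g (t, z) * plateau n a c z)).
  by apply: (integrable_bounded_mul (M := 1)) => // z _; exact: plateau_le1.
have := F0 n tab nr.
have -> : (fun z => F n (t, z)) =
    (fun z => f (t, z) * derive1 (plateau n a c) z + g (t, z) * plateau n a c z) \_ `[a, c + r].
  apply/funext => z; rewrite /F.
  have := sliceE f t tab; move/(congr1 (fun h => h z)) => /= ->.
  have := sliceE g t tab; move/(congr1 (fun h => h z)) => /= ->.
  by rewrite !patchE; case: ifP => // _; rewrite !mul0r addr0.
rewrite -Rintegral_mkcond RintegralD// => /eqP; rewrite addr_eq0 => /eqP <-.
apply: ae_eq_Rintegral => //.
- apply: measurable_funM => //.
  by apply: measurable_funTS; exact: continuous_measurable_fun.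
- by apply/measurable_EFinP; case/integrableP : k1.
by apply: filterS fw => z H zac; rewrite H.
Qed.

(** The argument of [ae_slice2_ftc] with the variables exchanged: the exceptional null set now
    consists of levels [z]. *)
Lemma ae_slice1_ftc (Omega : set (R * R)) (f g : R * R -> R) (al be a c r : R) :
  weak_derivative2 Omega (1, 0) f g -> a <= c -> 0 < r ->
  `[a, c + r] `*` `[al, be] `<=` Omega ->
  {ae mu, forall z, z \in `]al, be[ ->
    mu.-integrable `[a, c + r] (EFin \o (fun t => g (t, z))) /\
    forall w : R -> R, continuous w ->
      {ae mu, forall t, t \in `[a, c + r] -> f (t, z) = w t} ->
      w c - w a = \int[mu]_(t in `]a, c]) g (t, z)}.
Proof.
have FF := ae_filter_ringOfSetsType mu.
move=> [locfg wfg] ac r0 KO; pose K : set RR := `[a, c + r] `*` `[al, be].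
have mK : measurable K by apply: measurableX; exact: measurable_itv.
have [ifK0 igK0] : (mu2 R).-integrable K (EFin \o f) /\ (mu2 R).-integrable K (EFin \o g).
  by apply: locfg => //; apply: compact_setX; exact: segment_compact.
have ifK := integrable_patch_plane mK ifK0; have igK := integrable_patch_plane mK igK0.
pose F n x := (f \_ K) x * derive1 (plateau n a c) x.1 + (g \_ K) x * plateau n a c x.1.
have m2 (h : R -> R) : continuous h -> measurable_fun setT (fun x : RR => h x.2).
  by move=> ch; exact: (measurableT_comp (continuous_measurable_fun ch) measurable_snd).
have m1 (h : R -> R) : continuous h -> measurable_fun setT (fun x : RR => h x.1).
  by move=> ch; exact: (measurableT_comp (continuous_measurable_fun ch) measurable_fst).
have i1 n : (mu2 R).-integrable setT (EFin \o (fun x => (f \_ K) x * derive1 (plateau n a c) x.1)).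
  have [M HM] := derive1_plateau_bounded n ac.
  by apply: (integrable_bounded_mul (M := M)) => //; exact: m1 (@derive1_plateau_continuous R n a c).
have i2 n : (mu2 R).-integrable setT (EFin \o (fun x => (g \_ K) x * plateau n a c x.1)).
  apply: (integrable_bounded_mul (M := 1)) => //; first exact: m1 (@plateau_continuous R n a c).
  by move=> x _; exact: plateau_le1.
have iF n : (mu2 R).-integrable setT (EFin \o F n) by exact: integrable_realD (i1 n) (i2 n) _.
have F0 n : n.+1%:R^-1 <= r -> {ae mu, forall z, z \in `]al, be[ -> \int[mu]_t F n (t, z) = 0}.
  move=> nr; apply: ae_slice2_eq0 => // m p q alp pq qb.
  have sub : `[a, c + n.+1%:R^-1] `*` `[p, q + m.+1%:R^-1] `<=` K.
    move=> [t z] [/=]; rewrite !in_itv/= => /andP[az zc] /andP[pt tq]; split; rewrite /= in_itv/=.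
      by rewrite az (le_trans zc)// lerD2l.
    by rewrite (le_trans (ltW alp))// (le_trans tq).
  have tst := test_function_tensor ac pq (subset_trans sub KO).
  have out x : ~ K x -> (plateau m p q x.2 = 0) \/
      (plateau n a c x.1 = 0 /\ derive1 (plateau n a c) x.1 = 0).
    move=> nK; have [x1|x1] := boolP (x.2 \in `[p, q + m.+1%:R^-1]).
      have x2 : x.1 \notin `[a, c + n.+1%:R^-1].
        by apply/negP => x2; apply/nK/sub.
      by right; rewrite plateau_eq0// derive1_plateau_eq0.
    by left; rewrite plateau_eq0.
  have patch (h k : R * R -> R) : (forall x, ~ K x -> k x = 0) ->
      \int[mu2 R]_(x in Omega) (h x * k x) = \int[mu2 R]_x ((h \_ K) x * k x).
    move=> k0; rewrite (Rintegral_subset_eq0 (mu2 R) KO) => [|x nK]; last by rewrite k0// mulr0.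
    rewrite Rintegral_mkcond; apply: eq_Rintegral => x _; rewrite !patchE.
    by case: ifP => // _; rewrite mul0r.
  have := wfg _ tst.
  under eq_Rintegral do rewrite derive_tensor1.
  rewrite patch; last by move=> x /out[->|[_ ->]]; rewrite ?mul0r ?mulr0.
  rewrite patch; last by move=> x /out[|[]]; rewrite /tensor => ->; rewrite ?mul0r ?mulr0.
  move=> E.
  have mp : measurable_fun setT (fun x : RR => plateau m p q x.2).
    exact: m2 (@plateau_continuous R m p q).
  have j1 : (mu2 R).-integrable setT
      (EFin \o (fun x => (f \_ K) x * derive1 (plateau n a c) x.1 * plateau m p q x.2)).
    by apply: (integrable_bounded_mul (M := 1)) => // x _; exact: plateau_le1.
  have j2 : (mu2 R).-integrable setT
      (EFin \o (fun x => (g \_ K) x * plateau n a c x.1 * plateau m p q x.2)).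
    by apply: (integrable_bounded_mul (M := 1)) => // x _; exact: plateau_le1.
  rewrite /F; under eq_Rintegral do rewrite mulrDl.
  rewrite RintegralD//.
  under [X in X + _]eq_Rintegral do rewrite -mulrA.
  under [X in _ + X]eq_Rintegral do rewrite -mulrA.
  by rewrite E /tensor addNr.
have {}F0 : {ae mu, forall z n, z \in `]al, be[ -> n.+1%:R^-1 <= r -> \int[mu]_t F n (t, z) = 0}.
  apply: ae_foralln => n; have [nr|nr] := leP n.+1%:R^-1 r.
    by apply: filterS (F0 n nr) => t H tab _; exact: H.
  by apply: aeW => t _.
have sliceE (h : R * R -> R) z : z \in `]al, be[ ->
    (fun t => (h \_ K) (t, z)) = (fun t => h (t, z)) \_ `[a, c + r].
  move=> tab; apply/funext => t; rewrite !patchE; congr (if _ then _ else _).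
  have tc : `[al, be]%classic z by apply: subset_itv_oo_cc.
  apply/idP/idP => [/set_mem[H _]|/set_mem H]; exact: mem_set.
have slice (h : R * R -> R) z : z \in `]al, be[ ->
    mu.-integrable setT (EFin \o (fun t => (h \_ K) (t, z))) ->
    mu.-integrable `[a, c + r] (EFin \o (fun t => h (t, z))).
  move=> tab; rewrite (sliceE _ _ tab) => ih; apply/integrable_mkcond => //.
  by rewrite restrict_EFin.
apply: filterS3 F0 (ae_integrable_slice2 ifK) (ae_integrable_slice2 igK).
move=> z F0 /slice sf /slice sg tab; have {}sf := sf tab; have {}sg := sg tab.
split => // w cw fw.
apply: (@weak_derivative_plateau R w _ `[a, c + r] a c r) => // n nr.
have [M HM] := derive1_plateau_bounded n ac.
have mdp : measurable_fun `[a, c + r] (derive1 (plateau n a c)).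
  by apply: measurable_funTS; exact: continuous_measurable_fun (@derive1_plateau_continuous R n a c).
have mpl : measurable_fun `[a, c + r] (plateau n a c).
  by apply: measurable_funTS; exact: continuous_measurable_fun (@plateau_continuous R n a c).
have k1 : mu.-integrable `[a, c + r] (EFin \o (fun t => f (t, z) * derive1 (plateau n a c) t)).
  exact: (integrable_bounded_mul (M := M)).
have k2 : mu.-integrable `[a, c + r] (EFin \o (fun t => g (t, z) * plateau n a c t)).
  by apply: (integrable_bounded_mul (M := 1)) => // t _; exact: plateau_le1.
have := F0 n tab nr.
have -> : (fun t => F n (t, z)) =
    (fun t => f (t, z) * derive1 (plateau n a c) t + g (t, z) * plateau n a c t) \_ `[a, c + r].
  apply/funext => t; rewrite /F.
  have := sliceE f z tab; move/(congr1 (fun h => h t)) => /= ->.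
  have := sliceE g z tab; move/(congr1 (fun h => h t)) => /= ->.
  by rewrite !patchE; case: ifP => // _; rewrite !mul0r addr0.
rewrite -Rintegral_mkcond RintegralD// => /eqP; rewrite addr_eq0 => /eqP <-.
apply: ae_eq_Rintegral => //.
- apply: measurable_funM => //.
  by apply: measurable_funTS; exact: continuous_measurable_fun.
- by apply/measurable_EFinP; case/integrableP : k1.
by apply: filterS fw => t H zac; rewrite H.
Qed.

End slices.

(** * Continuous extensions, square integrability and endpoints *)

Lemma continuous_within_comp (T U V : topologicalType) (A : set U) (f : U -> V)
    (phi : T -> U) : {within A, continuous f} -> continuous phi ->
  (forall x, A (phi x)) -> continuous (fun x => f (phi x)).
Proof.
move=> /subspace_continuousP cf cphi Aphi x.
apply: cvg_trans (cf _ (Aphi x)) => B /= Bx.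
have := cphi x _ Bx; rewrite /nbhs/= /within/=.
by apply: filterS => y; apply.
Qed.

Lemma continuous_pair (T U V : topologicalType) (f : T -> U) (g : T -> V) :
  continuous f -> continuous g -> continuous (fun x => (f x, g x)).
Proof. by move=> cf cg x; exact: (cvg_pair (cf x) (cg x)). Qed.

Lemma continuous_comp_fst (R : realType) (T : topologicalType) (f : R -> T) :
  continuous f -> continuous (fun x : R * R => f x.1).
Proof. by move=> cf x; apply: (@continuous_comp _ _ _ fst f); [exact: cvg_fst|exact: cf]. Qed.

Lemma continuous_maxr (T : topologicalType) (R : realType) (f g : T -> R) :
  continuous f -> continuous g -> continuous (fun x => Num.max (f x) (g x)).
Proof. by move=> cf cg x; apply: continuous_max; [exact: cf|exact: cg]. Qed.

Lemma continuous_minr (T : topologicalType) (R : realType) (f g : T -> R) :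
  continuous f -> continuous g -> continuous (fun x => Num.min (f x) (g x)).
Proof. by move=> cf cg x; apply: continuous_min; [exact: cf|exact: cg]. Qed.

Definition clamp (R : realType) (lo hi x : R) : R := Num.max lo (Num.min x hi).

Lemma clamp_id (R : realType) (lo hi x : R) : lo <= x <= hi -> clamp lo hi x = x.
Proof. by move=> /andP[lx xh]; rewrite /clamp min_l// max_r. Qed.

Lemma clamp_itv (R : realType) (lo hi x : R) : lo <= hi -> lo <= clamp lo hi x <= hi.
Proof. by move=> lh; rewrite /clamp le_max lexx/= ge_max lh ge_min lexx orbT. Qed.

Lemma continuous_clamp (T : topologicalType) (R : realType) (lo hi f : T -> R) :
  continuous lo -> continuous hi -> continuous f ->
  continuous (fun x => clamp (lo x) (hi x) (f x)).
Proof. by move=> cl ch cf; apply: continuous_maxr => //; exact: continuous_minr. Qed.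

Lemma sigmaE (R : realType) (r : R) : sigma r = Num.max 0 r.
Proof. by rewrite /sigma /Num.max; case: ltgtP. Qed.

Lemma sigma_ge0 (R : realType) (r : R) : 0 <= sigma r.
Proof. by rewrite sigmaE le_max lexx. Qed.

Lemma le_sigma (R : realType) (r : R) : r <= sigma r.
Proof. by rewrite sigmaE le_max lexx orbT. Qed.

Lemma Lp2_integrable_sqr d (T : measurableType d) (R : realType)
    (nu : {measure set T -> \bar R}) (D : set T) (f : T -> R) : measurable D ->
  Lp nu 2%:E D f -> nu.-integrable D (EFin \o (fun x => f x ^+ 2)).
Proof.
move=> mD [mf]; rewrite /Lp_norm => /(poweR_lty 2); rewrite poweR_Lnorm// => fi.
apply/integrableP; split.
  by apply/measurable_EFinP; apply: measurable_funX.
rewrite integral_mkcond; apply: le_lt_trans fi.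
rewrite le_eqVlt; apply/orP; left; apply/eqP; apply: eq_integral => x _.
rewrite !patchE; case: ifP => _ /=.
  by rewrite ger0_norm ?sqr_ge0// powR_mulrn// real_normK ?num_real.
by rewrite normr0 powR0.
Qed.

(** On a set of finite measure the constant 1 is integrable, and [|f| <= f^2 + 1]. *)
Lemma integrable_of_sqr d (T : measurableType d) (R : realType)
    (nu : {measure set T -> \bar R}) (D : set T) (f : T -> R) : measurable D ->
  (nu D < +oo)%E -> measurable_fun D f ->
  nu.-integrable D (EFin \o (fun x => f x ^+ 2)) -> nu.-integrable D (EFin \o f).
Proof.
move=> mD nD mf i2.
have i1 : nu.-integrable D (EFin \o cst 1) by apply: measurable_bounded_integrable => //; exists 1; split; [exact: num_real|move=> M M1 x _ /=; rewrite normr1 ltW].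
have i12 := integrable_realD i2 i1 mD.
apply: le_integrable i12 => //; first exact/measurable_EFinP.
move=> x Dx /=; rewrite lee_fin [leRHS]ger0_norm ?addr_ge0 ?sqr_ge0//.
by have := sqr_ge0 (`|f x| - 1); have := normr_ge0 (f x); rewrite -[f x ^+ 2]real_normK ?num_real//; nra.
Qed.

Lemma ae_forall_count d (T : measurableType d) (R : realType)
    (nu : {measure set T -> \bar R}) (I : countType) (P : I -> T -> Prop) :
  (forall i, {ae nu, forall x, P i x}) -> {ae nu, forall x i, P i x}.
Proof.
move=> aeP.
have H : {ae nu, forall x n, if unpickle n is Some i then P i x else True}.
  by apply: ae_foralln => n; case: (unpickle n) => [i|]; [exact: aeP|exact: aeW].
by apply: filterS H => x H i; have := H (pickle i); rewrite pickleK.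
Qed.

Section endpoint_extension.
Variable R : realType.
Notation mu := (@lebesgue_measure R).
Implicit Types (f g w F : R -> R) (a b x y z : R).

Lemma weak_derivative1_ftc f g F a b : weak_derivative1 `]a, b[ f g -> continuous F ->
  (forall x, x \in `]a, b[ -> f x = F x) ->
  forall x y, a < x -> x <= y -> y < b -> F y - F x = \int[mu]_(t in `]x, y]) g t.
Proof.
move=> [loc wfg] cF fF x y ax xy yb; pose r := (b - y) / 2.
have r0 : 0 < r by rewrite divr_gt0// subr_gt0.
have yr : y + r < b by rewrite /r; lra.
have sub : `[x, y + r] `<=` `]a, b[.
  by move=> t /=; rewrite !in_itv/= => /andP[xt ty]; rewrite (lt_le_trans ax)//= (le_lt_trans ty).
have [_ ig] := loc _ (@segment_compact _ _ _) sub.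
apply: (@weak_derivative_plateau R F g `]a, b[ x y r) => // n nr.
rewrite -wfg; last first.
  apply: test_function_plateau => //; apply: subset_trans sub.
  by apply: subset_itvl; rewrite bnd_simp lerD2l.
by apply: eq_Rintegral => t; rewrite inE => tab; rewrite fF.
Qed.

(** The difference between [w] and the primitive of [g] is continuous on [[0, b]] and constant at
    the rational points inside, hence constant by density. Rational endpoints are what a single null
    set of slices can provide, and the conclusion includes the boundary points, where the boundary
    conditions are read. *)
Lemma ftc_extend_endpoints w g b : 0 < b -> continuous w ->
  mu.-integrable `[0, b] (EFin \o g) ->
  (forall p q : rat, 0 < (ratr p : R) -> (ratr p : R) <= ratr q -> (ratr q : R) < b ->
    w (ratr q) - w (ratr p) = \int[mu]_(t in `]ratr p, ratr q]) g t) ->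
  forall x y, 0 <= x -> x <= y -> y <= b -> w y - w x = \int[mu]_(t in `]x, y]) g t.
Proof.
move=> b0 cw ig wg.
have igoc : mu.-integrable `]0, b] (EFin \o g).
  by apply: integrableS ig => //; apply: subset_itvr; rewrite bnd_simp.
pose G x := \int[mu]_(t in `]0, x]) g t.
have cG : {within `[0, b], continuous G}.
  have := parameterized_integral_continuous (ltW b0) ig.
  apply: subspace_eq_continuous => x; rewrite inE/= in_itv/= => /andP[x0 xb].
  rewrite /parameterized_integral /from_subspace /G Rintegral_itv_obnd_cbnd//.
  by apply: integrableS igoc => //; apply: subset_itvl; rewrite bnd_simp.
pose Phi x := w (clamp 0 b x) - G (clamp 0 b x).
have cPhi : continuous Phi.
  have cc : continuous (clamp (0 : R) b).
    by apply: (@continuous_clamp R R (cst 0) (cst b) id) => x; [exact: cvg_cst|exact: cvg_cst|exact: cvg_id].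
  have cGc : continuous (fun x => G (clamp 0 b x)).
    by apply: (continuous_within_comp cG cc) => x; rewrite /= in_itv/= clamp_itv// ltW.
  move=> x; apply: cvgB; last exact: cGc.
  exact: (continuous_comp (cc x) (cw _)).
have [p pb] := rat_in_itvoo b0; move: pb; rewrite in_itv/= => /andP[p0 pb].
have Phiq q : 0 < (ratr q : R) -> (ratr q : R) < b -> Phi (ratr q) = Phi (ratr p).
  move=> q0 qb; rewrite /Phi !clamp_id ?(ltW p0) ?(ltW q0) ?(ltW pb) ?(ltW qb)//.
  have [pq|/ltW qp] := leP (ratr p : R) (ratr q).
  - have := wg _ _ p0 pq qb; have := Rintegral_oc_split igoc (ltW p0) pq (ltW qb).
    by rewrite -/(G _) => <-; rewrite /G; lra.
  - have := wg _ _ q0 qp pb; have := Rintegral_oc_split igoc (ltW q0) qp (ltW pb).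
    by rewrite -/(G _) => <-; rewrite /G; lra.
have Phix x : 0 <= x -> x <= b -> Phi x = Phi (ratr p).
  move=> x0 xb; apply/eqP; apply: contraT => /eqP nx.
  have dist0 : 0 < `|Phi x - Phi (ratr p)| by rewrite normr_gt0 subr_eq0; exact/eqP.
  have /cvgrPdist_lt /(_ _ dist0) /nbhs_ballP[e /= e0 He] := cPhi x.
  have : Num.max 0 (x - e) < Num.min b (x + e).
    by rewrite gt_max !lt_min b0 /=; apply/and3P; split; lra.
  move=> /rat_in_itvoo[q]; rewrite in_itv/= gt_max lt_min => /andP[/andP[q0 xq] /andP[qb qx]].
  have := He (ratr q); rewrite /ball/= Phiq// ltxx; apply.
  by rewrite ltr_norml; lra.
move=> x y x0 xy yb.
have := Phix x x0 (le_trans xy yb); have := Phix y (le_trans x0 xy) yb.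
rewrite /Phi (clamp_id (x := y)) ?(le_trans x0 xy)// (clamp_id (x := x)) ?x0 ?(le_trans xy yb)//.
have := Rintegral_oc_split igoc x0 xy yb; rewrite -/(G y) -/(G x) => <-; lra.
Qed.

End endpoint_extension.

Lemma Rintegral_cst_oc (R : realType) (c x y : R) : x <= y ->
  \int[@lebesgue_measure R]_(t in `]x, y]) c = c * (y - x).
Proof.
move=> xy; rewrite Rintegral_cst//; congr (_ * _).
have := @lebesgue_measure_itv R `]x, y]; rewrite /= lte_fin => E.
apply: (@EFin_inj R); rewrite fineK E; last by case: ifP.
by case: ltP => [//|yx]; congr EFin; apply/eqP; rewrite eq_sym subr_eq0 eq_le yx.
Qed.

(** * Regularity and slice inequality for a solution *)

Section solution_facts.
Variables (R : realType) (a0 gamma beta : R) (b s : R -> R) (u : R * R -> R) (T : R).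
Variables (s_t : R -> R) (u_t u_z u_zz : R * R -> R).
Notation mu := (@lebesgue_measure R).
Notation RR := (measurableTypeR R * measurableTypeR R)%type.
Hypotheses (a0_gt0 : 0 < a0) (gamma_gt0 : 0 < gamma) (beta_gt0 : 0 < beta) (T_gt0 : 0 < T).
Hypothesis cs : {within `[0, T], continuous s}.
Hypothesis ws : weak_derivative1 `]0, T[ s s_t.
Hypothesis s_gt0 : forall t, 0 <= t <= T -> 0 < s t.
Hypothesis cu : {within Qbar s T, continuous u}.
Hypothesis mut : measurable_fun (Q s T) u_t.
Hypothesis wut : weak_derivative2 (Q s T) (1, 0) u u_t.
Hypothesis wuzz : weak_derivative2 (Q s T) (0, 1) u_z u_zz.
Hypothesis L2 : Lp (mu2 R) 2%:E (Q s T) u_zz.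
Hypothesis slice_u : forall t, 0 <= t <= T ->
  weak_derivative1 `]0, s t[ (fun z => u (t, z)) (fun z => u_z (t, z)).
Hypothesis heat : {ae mu2 R, forall x, Q s T x -> u_t x - u_zz x = 0}.
Hypothesis bc_left : {ae mu1 R, forall t, 0 <= t <= T ->
  exists2 l, continuous_value 0 (s t) (fun z => u_z (t, z)) 0 l &
    - l = beta * (b t - gamma * u (t, 0))}.
Hypothesis bc_right : {ae mu1 R, forall t, 0 <= t <= T ->
  exists2 l, continuous_value 0 (s t) (fun z => u_z (t, z)) (s t) l &
    - l = u (t, s t) * s_t t}.
Hypothesis s_tE : {ae mu1 R, forall t, 0 <= t <= T -> s_t t = a0 * sigma (u (t, s t))}.

(* Clamping the arguments extends [s] and [u] continuously to the whole line and
   the whole plane. *)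
Definition s_ext (t : R) : R := s (clamp 0 T t).
Definition u_ext (x : R * R) : R := u (clamp 0 T x.1, clamp 0 (s_ext x.1) x.2).
(** By the free boundary law this is the continuous representative of [s_t]. *)
Definition speed (t : R) : R := a0 * sigma (u_ext (t, s_ext t)).
(** The extension by zero lets Fubini be applied on the whole plane. Through the heat equation the
    same function also acts as the time derivative of [u]. *)
Definition u_zz0 : R * R -> R := u_zz \_ (Q s T).

Let clampT t : 0 <= clamp 0 T t <= T. Proof. by rewrite clamp_itv// ltW. Qed.

Lemma s_extE t : 0 <= t <= T -> s_ext t = s t.
Proof. by move=> tT; rewrite /s_ext clamp_id. Qed.

Lemma s_ext_gt0 t : 0 < s_ext t.
Proof. exact/s_gt0/clampT. Qed.

Lemma u_extE t z : 0 <= t <= T -> 0 <= z <= s t -> u_ext (t, z) = u (t, z).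
Proof. by move=> tT zs; rewrite /u_ext/= s_extE// !clamp_id. Qed.

Lemma s_ext_continuous : continuous s_ext.
Proof.
have cc : continuous (clamp 0 T).
  by apply: (@continuous_clamp R R (cst 0) (cst T) id) => x; [exact: cvg_cst|exact: cvg_cst|exact: cvg_id].
have Ac t : `[0, T]%classic (clamp 0 T t) by rewrite /= in_itv/=.
exact (continuous_within_comp cs cc Ac).
Qed.

Lemma u_ext_continuous : continuous u_ext.
Proof.
pose phi (x : R * R) := (clamp 0 T x.1, clamp 0 (s_ext x.1) x.2).
have cphi : continuous phi.
  apply: continuous_pair.
    apply: (@continuous_clamp (R * R)%type R (cst 0) (cst T) fst) => y; [exact: cvg_cst|exact: cvg_cst|exact: cvg_fst].
  apply: (@continuous_clamp (R * R)%type R (cst 0) (fun x => s_ext x.1) snd).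
  - by move=> y; exact: cvg_cst.
  - exact: continuous_comp_fst s_ext_continuous.
  - by move=> y; exact: cvg_snd.
have Aphi x : Qbar s T (phi x).
  by split; [exact: clampT|rewrite /= -/(s_ext _) clamp_itv// ltW// s_ext_gt0].
exact (continuous_within_comp cu cphi Aphi).
Qed.

Lemma speed_continuous : continuous speed.
Proof.
have c1 : continuous (fun t : R => u_ext (t, s_ext t)).
  move=> t; apply: (@continuous_comp _ _ _ (fun t => (t, s_ext t)) u_ext).
    by apply: continuous_pair; [move=> r; exact: cvg_id|exact: s_ext_continuous].
  exact: u_ext_continuous.
move=> t; apply: cvgM; first exact: cvg_cst.
rewrite /continuous_at.
have -> : (fun t => sigma (u_ext (t, s_ext t))) = (fun t => Num.max 0 (u_ext (t, s_ext t))).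
  by apply/funext => r; rewrite sigmaE.
by rewrite sigmaE; apply: (@continuous_maxr R R (cst 0)) => // r; exact: cvg_cst.
Qed.

Lemma speed_ge0 t : 0 <= speed t.
Proof. by rewrite /speed mulr_ge0 ?sigma_ge0// ltW. Qed.

Lemma s_ext_ftc x y : 0 < x -> x <= y -> y < T ->
  s_ext y - s_ext x = \int[mu]_(t in `]x, y]) speed t.
Proof.
move=> x0 xy yT.
have sE t : t \in `]0, T[ -> s t = s_ext t.
  by rewrite in_itv/= => /andP[t0 tT]; rewrite s_extE// !ltW.
rewrite (weak_derivative1_ftc ws s_ext_continuous sE x0 xy yT).
have [loc _] := ws.
have sub : `[x, y] `<=` `]0, T[.
  by move=> t /=; rewrite !in_itv/= => /andP[xt ty]; rewrite (lt_le_trans x0)//= (le_lt_trans ty).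
have [_ ist] := loc _ (@segment_compact _ _ _) sub.
apply: ae_eq_Rintegral => //.
- apply/measurable_EFinP; apply: (measurable_int mu); apply: integrableS ist => //.
  by apply: subset_itvr; rewrite bnd_simp.
- apply: measurable_funTS; apply: continuous_measurable_fun; exact: speed_continuous.
have FF := ae_filter_ringOfSetsType (mu1 R).
apply: filterS s_tE => t st; rewrite /= in_itv/= => /andP[xt ty].
have tT : 0 <= t <= T by rewrite (ltW (lt_trans x0 xt)) ltW// (le_lt_trans ty).
rewrite st// /speed s_extE// u_extE// lexx andbT ltW//; exact: s_gt0.
Qed.

Lemma s_ext_nondecreasing x y : 0 < x -> x <= y -> y < T -> s_ext x <= s_ext y.
Proof.
move=> x0 xy yT; rewrite -subr_ge0 s_ext_ftc//.
by apply: Rintegral_ge0 => t _; exact: speed_ge0.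
Qed.

Lemma measurable_Q : measurable (Q s T : set RR).
Proof.
have -> : (Q s T : set RR) = (`]0, T[ `*` `]0, +oo[) `&`
    ((fun x : R * R => s_ext x.1 - x.2) @^-1` `]0, +oo[).
  apply/seteqP; split => -[t z]; rewrite /Q /= !in_itv/= !andbT subr_gt0.
    by move=> [/andP[t0 tT] /andP[z0 zs]]; rewrite s_extE ?t0 ?z0 ?tT ?(ltW t0) ?(ltW tT).
  by move=> [[/andP[t0 tT] z0]]; rewrite s_extE ?(ltW t0) ?(ltW tT)// t0 z0 tT => ->.
apply: measurableI; first by apply: measurableX; exact: measurable_itv.
have c : continuous (fun x : R * R => s_ext x.1 - x.2).
  by move=> x; apply: cvgB; [exact: (continuous_comp_fst s_ext_continuous)|exact: cvg_snd].
apply: open_measurable_plane; apply: open_comp; last exact: interval_open.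
by move=> x _; exact: c.
Qed.

Lemma mu2_Q_lty : (mu2 R (Q s T) < +oo)%E.
Proof.
have [M [_ sM]] : bounded_set (s_ext @` `[0, T]).
  apply: compact_bounded; apply: continuous_compact; last exact: segment_compact.
  exact/continuous_subspaceT/s_ext_continuous.
have sub : Q s T `<=` `[0, T] `*` `[0, `|M| + 1].
  move=> [t z] [/= /andP[t0 tT] /andP[z0 zs]]; split; rewrite /= in_itv/=.
    by rewrite !ltW.
  rewrite (ltW z0)/= (le_trans (ltW zs))//.
  rewrite (le_trans (ler_norm _))//; apply: sM.
    by rewrite (le_lt_trans (ler_norm M))// ltrDl.
  by exists t; rewrite /= ?in_itv/= ?(ltW t0) ?(ltW tT)// s_extE// !ltW.
apply: (@le_lt_trans _ _ (mu2 R (`[0, T] `*` `[0, `|M| + 1]))).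
  apply: le_measure => //; rewrite inE; first exact: measurable_Q.
  by apply: measurableX; exact: measurable_itv.
rewrite mu2_setX//; try exact: measurable_itv.
rewrite !lebesgue_measure_itv/= !lte_fin T_gt0 ltr_wpDl//.
by rewrite -!EFinB -EFinM ltry.
Qed.

Lemma integrable_u_zz0 : (mu2 R).-integrable setT (EFin \o u_zz0).
Proof.
apply: integrable_patch_plane; first exact: measurable_Q.
have [mf _] := L2; apply: integrable_of_sqr => //.
- exact: measurable_Q.
- exact: mu2_Q_lty.
- by apply: Lp2_integrable_sqr => //; exact: measurable_Q.
Qed.

Lemma integrable_u_zz0_sqr : (mu2 R).-integrable setT (EFin \o (fun x => u_zz0 x ^+ 2)).
Proof.
rewrite (_ : (fun x => u_zz0 x ^+ 2) = (fun x => u_zz x ^+ 2) \_ (Q s T)).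
  apply: integrable_patch_plane; first exact: measurable_Q.
  by apply: Lp2_integrable_sqr => //; exact: measurable_Q.
by apply/funext => x; rewrite /u_zz0 !patchE; case: ifP => // _; rewrite expr0n.
Qed.

Lemma u_zz0E t z : 0 < t -> t < T -> 0 < z -> z < s_ext t -> u_zz0 (t, z) = u_zz (t, z).
Proof.
move=> t0 tT z0; rewrite s_extE ?(ltW t0) ?(ltW tT)// => zs.
by rewrite /u_zz0 patchE mem_set//; split; rewrite /= ?t0 ?z0.
Qed.

(** Since [u_t = u_zz] almost everywhere, [u_zz] is itself a weak time derivative. Increments of [u]
    in time and of [u_z] in space are then integrals of one and the same function. *)
Lemma weak_derivative2_u_zz : weak_derivative2 (Q s T) (1, 0) u u_zz.
Proof.
have [loc1 w1] := wut; have [loc2 _] := wuzz; split => [K cK KQ|phi tphi].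
  by split; [have [] := loc1 K cK KQ|have [] := loc2 K cK KQ].
rewrite w1//; congr (- _).
have mphi : measurable_fun (Q s T : set RR) phi.
  apply: measurable_funTS; apply: continuous_measurable_fun_plane.
  by have [sphi _ _] := tphi; have [] := sphi [::].
have [mzz _] := L2.
apply: ae_eq_Rintegral => //; [exact: measurable_Q|exact: measurable_funM|exact: measurable_funM|].
have FF := ae_filter_ringOfSetsType (mu2 R).
by apply: filterS heat => x hx Qx; move/eqP: (hx Qx); rewrite subr_eq0 => /eqP ->.
Qed.

(** The front never recedes, so a rectangle over [[x, y + r]] whose levels stay strictly between 0
    and [s_ext x] is contained in [Q s T]. Shrinking margins [k.+1%:R^-1] exhaust all levels with
    countably many null sets; [r] leaves the room to the right of [y] that the plateaux use. *)
Lemma u_ext_time_ftc x y : 0 < x -> x <= y -> y < T ->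
  {ae mu, forall z, 0 < z < s_ext x ->
    u_ext (y, z) - u_ext (x, z) = \int[mu]_(t in `]x, y]) u_zz0 (t, z)}.
Proof.
move=> x0 xy yT; have FF := ae_filter_ringOfSetsType mu.
pose r := (T - y) / 2; have r0 : 0 < r by rewrite divr_gt0// subr_gt0.
have yr : y + r < T by rewrite /r; lra.
have H : {ae mu, forall z k, z \in `](k.+1%:R^-1 : R), (s_ext x - k.+1%:R^-1)[ ->
    u_ext (y, z) - u_ext (x, z) = \int[mu]_(t in `]x, y]) u_zz (t, z)}.
  apply: ae_foralln => k; have k0 : 0 < k.+1%:R^-1 :> R by rewrite invr_gt0.
  have sub : `[x, y + r] `*` `[(k.+1%:R^-1 : R), s_ext x - k.+1%:R^-1] `<=` Q s T.
    move=> [t z] [/=]; rewrite !in_itv/= => /andP[xt ty] /andP[kz zs].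
    have t0 : 0 < t by rewrite (lt_le_trans x0).
    have tT : t < T by rewrite (le_lt_trans ty).
    rewrite /Q /= t0 tT (lt_le_trans k0 kz) -(@s_extE t) ?(ltW t0) ?(ltW tT)//=.
    rewrite (le_lt_trans zs)// ltrBlDr ltr_pwDr//.
    exact: s_ext_nondecreasing.
  apply: filterS (ae_slice1_ftc weak_derivative2_u_zz xy r0 sub) => z Hz zk.
  have [_ Hw] := Hz zk; apply: (Hw (fun t => u_ext (t, z))).
    move=> t; apply: (@continuous_comp _ _ _ (fun t => (t, z)) u_ext).
      by apply: continuous_pair; [move=> q; exact: cvg_id|move=> q; exact: cvg_cst].
    exact: u_ext_continuous.
  apply: aeW => t txy; have [|] := sub (t, z).
    by split => //; apply: subset_itv_oo_cc.
  move=> /= /andP[t0 tT] /andP[z0 zs]; rewrite u_extE// ?(ltW t0) ?(ltW tT)//.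
  by rewrite (ltW z0) ltW.
apply: filterS H => z Hz /andP[z0 zs].
have d0 : 0 < Num.min z (s_ext x - z) by rewrite lt_min z0 subr_gt0.
have [k _ /(_ k (leqnn k))] := near_infty_natSinv_lt (PosNum d0).
rewrite /= lt_min => /andP[kz ks].
rewrite (Hz k); last by rewrite in_itv/= kz ltrBrDr -ltrBrDl.
apply: eq_Rintegral => t; rewrite inE/= in_itv/= => /andP[xt ty].
have t0 := lt_trans x0 xt; have tT := le_lt_trans ty yT.
by rewrite u_zz0E// (lt_le_trans zs)// s_ext_nondecreasing// ltW.
Qed.

(** [slice_u] is available at every time, so this formula holds on every interior slice. It comes
    from compact subintervals of []0, s t[] and reaches the endpoints by continuity. *)
Lemma slice_u_ftc t w : 0 < t -> t < T -> continuous w ->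
  {ae mu, forall z, z \in `]0, s t[ -> u_z (t, z) = w z} ->
  forall x y, 0 <= x -> x <= y -> y <= s_ext t ->
    u_ext (t, y) - u_ext (t, x) = \int[mu]_(z in `]x, y]) w z.
Proof.
move=> t0 tT cw ew; have tT' : 0 <= t <= T by rewrite !ltW.
have cu1 : continuous (fun z => u_ext (t, z)).
  move=> z; apply: (@continuous_comp _ _ _ (fun z => (t, z)) u_ext).
    by apply: continuous_pair; [move=> q; exact: cvg_cst|move=> q; exact: cvg_id].
  exact: u_ext_continuous.
apply: (ftc_extend_endpoints (s_ext_gt0 t) cu1); first exact: integrable_continuous.
move=> p q p0 pq qs; rewrite s_extE// in qs.
have uE z : z \in `]0, s t[ -> u (t, z) = u_ext (t, z).
  by rewrite in_itv/= => /andP[z0 zs]; rewrite u_extE// !ltW.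
rewrite (weak_derivative1_ftc (slice_u tT') cu1 uE p0 pq qs).
have [loc _] := slice_u tT'.
have sub : `[(ratr p : R), ratr q] `<=` `]0, s t[.
  by move=> z /=; rewrite !in_itv/= => /andP[pz zq]; rewrite (lt_le_trans p0)//= (le_lt_trans zq).
have [_ iz] := loc _ (@segment_compact _ _ _) sub.
apply: ae_eq_Rintegral => //.
- apply/measurable_EFinP; apply: (measurable_int mu); apply: integrableS iz => //.
  by apply: subset_itvr; rewrite bnd_simp.
- by apply: measurable_funTS; exact: continuous_measurable_fun.
have FF := ae_filter_ringOfSetsType mu.
apply: filterS ew => z ew zpq; apply: ew; apply: sub.
by apply: subset_itv_oc_cc.
Qed.

(** The length of a slice depends on [t], so the rectangle on which the weak identity is used has to
    be chosen after [t]. Taking all its data rational leaves a countable family, hence one null set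
    of times fixed in advance. *)
Lemma slice_u_z_ftc : {ae mu, forall t, 0 < t < T -> 
  mu.-integrable setT (EFin \o (fun z => u_zz0 (t, z))) /\
  forall w, continuous w -> {ae mu, forall z, z \in `]0, s t[ -> u_z (t, z) = w z} ->
  forall x y, 0 <= x -> x <= y -> y <= s_ext t ->
    w y - w x = \int[mu]_(z in `]x, y]) u_zz0 (t, z)}.
Proof.
have FF := ae_filter_ringOfSetsType mu.
pose I : countType := ((rat * rat) * (rat * rat) * rat)%type.
have H : {ae mu, forall t (i : I),
    let: ((al, be), (p, q), r) := i in
    `[(ratr al : R), ratr be] `*` `[(ratr p : R), ratr q + ratr r] `<=` Q s T ->
    ratr p <= (ratr q : R) -> 0 < (ratr r : R) -> t \in `](ratr al : R), ratr be[ ->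
    forall w : R -> R, continuous w ->
      {ae mu, forall z, z \in `[(ratr p : R), ratr q + ratr r] -> u_z (t, z) = w z} ->
      w (ratr q) - w (ratr p) = \int[mu]_(z in `](ratr p : R), ratr q]) u_zz (t, z)}.
  apply: ae_forall_count => -[[[al be] [p q]] r].
  have [sub|nsub] := pselect (`[(ratr al : R), ratr be] `*` `[(ratr p : R), ratr q + ratr r] `<=` Q s T);
    last exact: aeW.
  have [pq|pq] := boolP (ratr p <= (ratr q : R)); last exact: aeW.
  have [r0|r0] := boolP (0 < (ratr r : R)); last exact: aeW.
  apply: filterS (ae_slice2_ftc wuzz pq r0 sub) => t Ht _ _ _ tab w cw ew.
  by have [_ Hw] := Ht tab; exact: Hw.
apply: filterS2 H (ae_integrable_slice1 integrable_u_zz0) => t Ht it /andP[t0 tT].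
split => // w cw ew.
apply: (ftc_extend_endpoints (s_ext_gt0 t) cw); first exact: integrableS it.
move=> p q p0 pq qs.
have cs_t := @s_ext_continuous t.
have /rat_in_itvoo[r] : 0 < s_ext t - ratr q by rewrite subr_gt0.
rewrite in_itv/= => /andP[r0 rs].
(* Continuity of [s_ext] serves only to place the left end [al] of the time interval. To the right
   of [al] the rectangle stays inside the domain because [s_ext] is nondecreasing. *)
have [d d0 Hd] : exists2 d, 0 < d & forall t', `|t - t'| < d -> ratr q + ratr r < s_ext t'.
  have e0 : 0 < s_ext t - (ratr q + ratr r) by lra.
  have /cvgrPdist_lt /(_ _ e0) /nbhs_ballP[d /= d0 Hd] := cs_t.
  by exists d => // t' /Hd; rewrite ltr_norml => /andP[_]; lra.
have /rat_in_itvoo[al] : Num.max 0 (t - d) < t by rewrite gt_max t0; lra.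
rewrite in_itv/= gt_max => /andP[/andP[al0 ald] alt].
have /rat_in_itvoo[be] := tT; rewrite in_itv/= => /andP[tbe beT].
have sub : `[(ratr al : R), ratr be] `*` `[(ratr p : R), ratr q + ratr r] `<=` Q s T.
  move=> [t' z] [/=]; rewrite !in_itv/= => /andP[alt' t'be] /andP[pz zq].
  have t'0 : 0 < t' by rewrite (lt_le_trans al0).
  have t'T : t' < T by rewrite (le_lt_trans t'be).
  rewrite /Q /= t'0 t'T (lt_le_trans p0)//= -(@s_extE t') ?(ltW t'0) ?(ltW t'T)//.
  rewrite (le_lt_trans zq)// (lt_le_trans (Hd (ratr al) _))//.
    by rewrite ltr_norml; lra.
  by apply: s_ext_nondecreasing.
have := Ht ((al, be), (p, q), r) sub pq r0; rewrite in_itv/= alt tbe => /(_ isT w cw) ->.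
  apply: eq_Rintegral => z; rewrite inE/= in_itv/= => /andP[pz zq].
  by rewrite u_zz0E// ?(lt_trans p0)// (le_lt_trans zq).
apply: filterS ew => z ew; rewrite in_itv/= => /andP[pz zq]; apply: ew.
rewrite in_itv/= (lt_le_trans p0 pz)/= -(@s_extE t) ?(ltW t0) ?(ltW tT)//.
by rewrite (le_lt_trans zq)//; lra.
Qed.

(* The dropped terms are [eps * u_z ^+ 2], integrated over the slice, and
   [eps * beta * gamma * (u (t, 0) - b t / (2 * gamma)) ^+ 2]. *)
Lemma slice_energy eps : 0 <= eps -> {ae mu, forall t, 0 < t < T ->
  beta * b t - eps * beta * b t ^+ 2 / (4 * gamma) - beta * gamma * u_ext (t, s_ext t)
    - (1 + beta * gamma * s_ext t - eps * u_ext (t, s_ext t)) * u_ext (t, s_ext t) * speed t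
  <= \int[mu]_(z in `]0, s_ext t])
       ((1 + beta * gamma * z - eps * u_ext (t, z)) * u_zz0 (t, z))}.
Proof.
move=> eps0; have FF := ae_filter_ringOfSetsType mu.
have H1 := @filterI _ _ FF _ _ bc_left (@filterI _ _ FF _ _ bc_right s_tE).
apply: (@filterS2 _ _ FF _ _ _ _ slice_u_z_ftc H1) => t Ht [Hl [Hr Hs]] /andP[t0 tT].
have tT' : 0 <= t <= T by rewrite !ltW.
have tT2 : 0 < t < T by rewrite t0.
have {Ht} [ig wg] := Ht tT2.
have {Hl} [l0 [w0 [cw0 ew0 w00]] l0E] := Hl tT'.
have {Hr} [l1 [w1 [cw1 ew1 w1s]] l1E] := Hr tT'.
have {Hs} stE := Hs tT'.
set S := s_ext t; have SE : S = s t by exact: s_extE.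
have S0 : 0 < S by exact: s_ext_gt0.
have cc : continuous (clamp 0 (s t)).
  by apply: (@continuous_clamp R R (cst 0) (cst (s t)) id) => x; [exact: cvg_cst|exact: cvg_cst|exact: cvg_id].
have Ac z : `[0, s t]%classic (clamp 0 (s t) z) by rewrite /= in_itv/= clamp_itv// -SE ltW.
(* The two boundary conditions supply two continuous representatives of [u_z (t, _)], which have to
   be identified before both boundary values can be used together. *)
pose W0 z := w0 (clamp 0 (s t) z); pose W1 z := w1 (clamp 0 (s t) z).
have cW0 : continuous W0 := continuous_within_comp cw0 cc Ac.
have cW1 : continuous W1 := continuous_within_comp cw1 cc Ac.
have eW0 : {ae mu, forall z, z \in `]0, s t[ -> u_z (t, z) = W0 z}.
  apply: filterS ew0 => z H zs; rewrite H//; move: zs; rewrite in_itv/= => /andP[z0 zs].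
  by rewrite /W0 clamp_id// !ltW.
have eW1 : {ae mu, forall z, z \in `]0, s t[ -> u_z (t, z) = W1 z}.
  apply: filterS ew1 => z H zs; rewrite H//; move: zs; rewrite in_itv/= => /andP[z0 zs].
  by rewrite /W1 clamp_id// !ltW.
have W0g := wg _ cW0 eW0; have W1g := wg _ cW1 eW1.
have uW0 := slice_u_ftc t0 tT cW0 eW0; have uW1 := slice_u_ftc t0 tT cW1 eW1.
have iW0 x y : mu.-integrable `]x, y] (EFin \o W0).
  by apply: integrableS (integrable_continuous x y cW0) => //; apply: subset_itvr; rewrite bnd_simp.
have iW1 x y : mu.-integrable `]x, y] (EFin \o W1).
  by apply: integrableS (integrable_continuous x y cW1) => //; apply: subset_itvr; rewrite bnd_simp.
have icst (c x y : R) : mu.-integrable `]x, y] (EFin \o cst c).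
  apply: integrableS (@integrable_continuous R (cst c) x y _) => //.
    by apply: subset_itvr; rewrite bnd_simp.
  exact: cst_continuous.
(* Both representatives have the increments given by [u_zz0], so they differ by a constant. Their
   integrals over the slice both equal [u_ext (t, S) - u_ext (t, 0)], and [S > 0], so this constant
   is 0. *)
have W01 : W0 0 = W1 0.
  have E : \int[mu]_(z in `]0, S]) W0 z = \int[mu]_(z in `]0, S]) (W1 z + (W0 0 - W1 0)).
    apply: eq_Rintegral => z; rewrite inE/= in_itv/= => /andP[z0 zS].
    by have := W0g 0 z (lexx _) (ltW z0) zS; rewrite -(W1g 0 z (lexx _) (ltW z0) zS); lra.
  move: E; rewrite RintegralD//; last exact: icst.
  rewrite Rintegral_cst_oc ?(ltW S0)// -uW0 ?(ltW S0)// -uW1 ?(ltW S0)// subr0.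
  move/eqP; rewrite -subr_eq0 opprD addrA subrr add0r oppr_eq0 mulf_eq0 (gt_eqF S0) orbF.
  by rewrite subr_eq0 => /eqP.
have W0S : W0 S = l1.
  have := W0g 0 S (lexx _) (ltW S0) (lexx _).
  rewrite -(W1g 0 S (lexx _) (ltW S0) (lexx _)) W01.
  by move=> /addIr ->; rewrite /W1 SE clamp_id ?w1s// lexx -SE ltW.
have W00 : W0 0 = l0 by rewrite /W0 clamp_id// lexx -SE ltW.
pose k := beta * gamma.
pose p z := 1 + k * z - eps * u_ext (t, z).
have cut : continuous (fun z => u_ext (t, z)).
  move=> z; apply: (@continuous_comp _ _ _ (fun z => (t, z)) u_ext).
    by apply: continuous_pair; [move=> q; exact: cvg_cst|move=> q; exact: cvg_id].
  exact: u_ext_continuous.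
have cp : continuous p.
  move=> z; apply: cvgB; last by apply: cvgM; [exact: cvg_cst|exact: cut].
  by apply: cvgD; [exact: cvg_cst|apply: cvgM; [exact: cvg_cst|exact: cvg_id]].
have ip' x y : mu.-integrable `]x, y] (EFin \o (fun z => k - eps * W0 z)).
  exact: integrable_realB (icst k x y) (integrable_realZl eps (iW0 x y) (measurable_itv _)) (measurable_itv _).
have igS : mu.-integrable `]0, S] (EFin \o (fun z => u_zz0 (t, z))) by exact: integrableS ig.
have pE x y : 0 <= x -> x <= y -> y <= S -> p y - p x = \int[mu]_(z in `]x, y]) (k - eps * W0 z).
  move=> x0 xy yS; rewrite RintegralB//; [|exact: icst|exact: integrable_realZl].
  by rewrite [X in _ = _ - X]RintegralZl// Rintegral_cst_oc// -uW0// /p; ring.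
have := Rintegration_by_parts_ac (ltW S0) cp cW0 (ip' 0 S) igS pE W0g.
have i1 := integrable_continuousMl cp igS.
have i2 := integrable_continuousMl cW0 (ip' 0 S).
rewrite RintegralD// W0S W00.
have : \int[mu]_(z in `]0, S]) (W0 z * (k - eps * W0 z)) <= \int[mu]_(z in `]0, S]) (k * W0 z).
  apply: le_Rintegral => //; first exact: integrable_realZl.
  move=> z _; rewrite -subr_ge0 (_ : _ - _ = eps * W0 z ^+ 2); last by ring.
  by rewrite mulr_ge0 ?sqr_ge0.
rewrite RintegralZl// -uW0 ?(ltW S0)//.
have us : u (t, s t) = u_ext (t, S) by rewrite SE u_extE// lexx andbT -SE ltW.
have u0E : u (t, 0) = u_ext (t, 0) by rewrite u_extE// lexx -SE ltW.
rewrite us u0E in l0E l1E stE; have spE : s_t t = speed t by rewrite /speed.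
rewrite spE in l1E.
rewrite -/(p _) /p -/k mulr0 addr0.
set I1 := Rintegral _ _ _; set I2 := Rintegral _ _ _ => h1 h2.
set us_ := u_ext (t, S) in h1 h2 l1E *; set u0_ := u_ext (t, 0) in h1 h2 l0E *.
have sq : 0 <= eps * beta * gamma * (u0_ - b t / (2 * gamma)) ^+ 2.
  exact: mulr_ge0 (mulr_ge0 (mulr_ge0 eps0 (ltW beta_gt0)) (ltW gamma_gt0)) (sqr_ge0 _).
have sqE : eps * beta * gamma * (u0_ - b t / (2 * gamma)) ^+ 2 =
    eps * beta * gamma * u0_ ^+ 2 - eps * beta * u0_ * b t + eps * beta * b t ^+ 2 / (4 * gamma).
  by field; rewrite gt_eqF.
have l0E' : l0 = - (beta * (b t - gamma * u0_)) by rewrite -l0E opprK.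
have l1E' : l1 = - (us_ * speed t) by rewrite -l1E opprK.
have h3 : I2 = (1 + k * S - eps * us_) * l1 - (1 - eps * u0_) * l0 - I1 by rewrite h2; ring.
rewrite h3 l0E' l1E' sqE in sq *.
suff : k * (us_ - u0_) <= - (1 - eps * u0_) * - (beta * (b t - gamma * u0_)) -
   beta * b t + eps * beta * b t ^+ 2 / (4 * gamma) + k * us_.
  move=> h4; have := le_trans h1 h4; rewrite /k; lra.
by rewrite /k; lra.
Qed.

End solution_facts.

Lemma ae_le_Rintegral d (T : measurableType d) (R : realType)
    (nu : {measure set T -> \bar R}) (D : set T) (f g : T -> R) : measurable D ->
  nu.-integrable D (EFin \o f) -> nu.-integrable D (EFin \o g) ->
  {ae nu, forall x, D x -> f x <= g x} ->
  \int[nu]_(x in D) f x <= \int[nu]_(x in D) g x.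
Proof.
move=> mD fi gi fg; rewrite -subr_ge0 -RintegralB//.
have gfi := integrable_realB gi fi mD.
rewrite (@ae_eq_Rintegral _ _ _ nu D _ (fun x => `|g x - f x|))//.
- by apply: Rintegral_ge0 => x _; exact: normr_ge0.
- by apply/measurable_EFinP; case/integrableP : gfi.
- by apply/measurable_EFinP; case/integrableP : (integrable_real_norm gfi mD).
by apply: filterS fg => x fg Dx; rewrite ger0_norm// subr_ge0 fg.
Qed.

(** * Growth of the energy *)

(* [U] is the solution and [g] its time derivative, [P] is the test function and
   [G] the energy density, an antiderivative of [P] in [U] (hypothesis [GP]);
   [v] is the speed of the free boundary [S]. *)
Section energy_growth.
Variables (R : realType) (S v : R -> R) (U P G g : R * R -> R) (c k T : R).
Notation mu := (@lebesgue_measure R).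
Notation RR := (measurableTypeR R * measurableTypeR R)%type.
Hypotheses (cS : continuous S) (cv : continuous v) (cP : continuous P) (cG : continuous G).
Hypothesis S_gt0 : forall t, 0 < S t.
Hypothesis v_ge0 : forall t, 0 <= v t.
Hypothesis S_ftc : forall x y, 0 < x -> x <= y -> y < T ->
  S y - S x = \int[mu]_(t in `]x, y]) v t.
Hypothesis ig : (mu2 R).-integrable setT (EFin \o g).
Hypothesis ig2 : (mu2 R).-integrable setT (EFin \o (fun x => g x ^+ 2)).
Hypothesis U_ftc : forall x y, 0 < x -> x <= y -> y < T ->
  {ae mu, forall z, 0 < z < S x ->
    U (y, z) - U (x, z) = \int[mu]_(t in `]x, y]) g (t, z)}.
(** The trapezoidal rule is exact for a density quadratic in [U]; no remainder in the increment of
    [U] has to be estimated. *)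
Hypothesis GP : forall x y z,
  G (y, z) - G (x, z) = (P (x, z) + P (y, z)) / 2 * (U (y, z) - U (x, z)).
Hypothesis energy : {ae mu, forall t, 0 < t < T ->
  c - k * v t - G (t, S t) * v t <= \int[mu]_(z in `]0, S t]) (P (t, z) * g (t, z))}.

Definition energy_functional t :=
  \int[mu]_(z in `]0, S t]) G (t, z) - c * t + k * S t.

Let S_nondecreasing x y : 0 < x -> x <= y -> y < T -> S x <= S y.
Proof.
by move=> x0 xy yT; rewrite -subr_ge0 S_ftc//; apply: Rintegral_ge0 => t _; exact: v_ge0.
Qed.

Let slice_continuous (F : R * R -> R) t : continuous F -> continuous (fun z => F (t, z)).
Proof.
move=> cF z; apply: (@continuous_comp _ _ _ (fun z => (t, z)) F); last exact: cF.
by apply: continuous_pair => q; [exact: cvg_cst|exact: cvg_id].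
Qed.

Let integrable_oc (f : R -> R) x y : continuous f -> mu.-integrable `]x, y] (EFin \o f).
Proof.
move=> cf; apply: integrableS (integrable_continuous x y cf) => //.
by apply: subset_itvr; rewrite bnd_simp.
Qed.

(** The time density that pays for the errors: [|g|] for the oscillation of the test function, [g^2]
    for the AM-GM step. Its primitive is additive over a partition. *)
Let rho t := \int[mu]_z (`|g (t, z)| + g (t, z) ^+ 2).

Let iabs : (mu2 R).-integrable setT (EFin \o (fun x => `|g x| + g x ^+ 2)).
Proof. by apply: integrable_realD => //; exact: integrable_real_norm. Qed.

Let irho : mu.-integrable setT (EFin \o rho).
Proof. exact: (integrable_Rintegral_slice1 iabs). Qed.

(** Below [S x] the slice is present during the whole slab, so the energy change there is integrated
    in time first, level by level, and becomes a planar integral of [g] against the average of [P]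
    at the two end times. The bound [N] gives integrability. *)
Let difference_part x y (N : R) : 0 < x -> x <= y -> y < T ->
  (forall z, 0 <= z <= S x -> `|(P (x, z) + P (y, z)) / 2| <= N) ->
  let F := (fun w => g w * ((P (x, w.2) + P (y, w.2)) / 2)) \_ (`]x, y] `*` `]0, S x[) in
  (mu2 R).-integrable setT (EFin \o F) /\
  \int[mu]_(z in `]0, S x]) (G (y, z) - G (x, z)) = \int[mu2 R]_w F w.
Proof.
move=> x0 xy yT PN F; set q := fun z => (P (x, z) + P (y, z)) / 2.
have cq : continuous q.
  move=> z; apply: cvgM; last exact: cvg_cst.
  by apply: cvgD; exact: slice_continuous.
pose K : set RR := `]x, y] `*` `]0, S x[.
have mK : measurable K by apply: measurableX; exact: measurable_itv.
have iF : (mu2 R).-integrable setT (EFin \o F).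
  apply: integrable_patch_plane => //; apply: (integrable_bounded_mul (M := N)) => //.
  - exact: integrableS ig.
  - apply: measurable_funTS.
    exact: (measurableT_comp (continuous_measurable_fun cq) measurable_snd).
  - by move=> [t z] [_ /=]; rewrite in_itv/= => /andP[z0 zS]; apply: PN; rewrite !ltW.
split => //; rewrite -(Rintegral_slice2 iF).
have FE z : z \in `]0, S x[ -> \int[mu]_t F (t, z) = \int[mu]_(t in `]x, y]) (g (t, z) * q z).
  move=> zS; rewrite [RHS]Rintegral_mkcond; apply: eq_Rintegral => t _.
  rewrite /F !patchE; congr (if _ then _ else _).
  by apply/idP/idP => [/set_mem[H _]|/set_mem H]; exact: mem_set.
have F0 z : ~ `]0, S x[%classic z -> \int[mu]_t F (t, z) = 0.
  move=> zS; rewrite (_ : (fun t => F (t, z)) = cst 0); last first.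
    by apply/funext => t; rewrite /F patchE memNset// => -[].
  by rewrite Rintegral_cst// mul0r.
have cD : continuous (fun z => G (y, z) - G (x, z)).
  by move=> z; apply: cvgB; exact: slice_continuous.
rewrite (Rintegral_subset_eq0 mu (K := `]0, S x[%classic) (D := setT))//.
rewrite -Rintegral_itv_bndo_bndc; last first.
  by apply: integrableS (integrable_oc 0 (S x) cD) => //; apply: subset_itvl; rewrite bnd_simp.
apply: ae_eq_Rintegral => //.
- by apply: measurable_funTS; exact: continuous_measurable_fun.
- apply: measurable_funTS; apply/measurable_EFinP.
  by case/integrableP : (integrable_Rintegral_slice2 iF).
have FF := ae_filter_ringOfSetsType mu.
apply: (@filterS2 _ _ FF _ _ _ _ (U_ftc x0 xy yT) (ae_integrable_slice2 ig)) => z Uz iz zS.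
rewrite FE// RintegralZr//; last exact: integrableS iz.
by rewrite -Uz// GP mulrC.
Qed.

Let swept x y : set RR :=
  [set w | w.1 \in `]x, y] /\ w.2 \in `]0, S w.1]].

Let measurable_swept x y : measurable (swept x y).
Proof.
have -> : swept x y = (`]x, y] `*` `]0, +oo[) `&` ((fun w : RR => S w.1 - w.2) @^-1` `[0, +oo[).
  apply/seteqP; split => -[t z]; rewrite /swept/= !in_itv/= !andbT subr_ge0.
    by move=> [-> /andP[-> ->]].
  by move=> [[-> ->] ->].
apply: measurableI; first by apply: measurableX; exact: measurable_itv.
rewrite -[X in measurable X]setTI.
apply: continuous_measurable_fun_plane => //.
by move=> w; apply: cvgB; [exact: (continuous_comp_fst cS)|exact: cvg_snd].
Qed.

(** The slice inequality integrated over []x, y]]; Fubini is now used with the space integral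
    inside, which matches the form of [energy]. *)
Let swept_part x y (N : R) : 0 < x -> x <= y -> y < T ->
  (forall t z, x <= t <= y -> 0 <= z <= S t -> `|P (t, z)| <= N) ->
  let F := (fun w => g w * P w) \_ (swept x y) in
  (mu2 R).-integrable setT (EFin \o F) /\
  c * (y - x) - k * (S y - S x) - \int[mu]_(t in `]x, y]) (G (t, S t) * v t)
    <= \int[mu2 R]_w F w.
Proof.
move=> x0 xy yT PN F.
have iF : (mu2 R).-integrable setT (EFin \o F).
  apply: integrable_patch_plane; first exact: measurable_swept.
  apply: (integrable_bounded_mul (M := N)); first exact: measurable_swept.
  - by apply: integrableS ig => //; exact: measurable_swept.
  - by apply: measurable_funTS; exact: continuous_measurable_fun_plane.
  - move=> [t z] [/=]; rewrite !in_itv/= => /andP[xt ty] /andP[z0 zS].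
    by apply: PN; rewrite ?(ltW xt) ?(ltW z0).
split => //; rewrite -(Rintegral_slice1 iF).
have FE t : t \in `]x, y] -> \int[mu]_z F (t, z) = \int[mu]_(z in `]0, S t]) (P (t, z) * g (t, z)).
  move=> txy; rewrite [RHS]Rintegral_mkcond; apply: eq_Rintegral => z _.
  rewrite /F !patchE mulrC; congr (if _ then _ else _).
  by apply/idP/idP => [/set_mem[_ H]|/set_mem H]; exact: mem_set.
have F0 t : ~ `]x, y]%classic t -> \int[mu]_z F (t, z) = 0.
  move=> txy; rewrite (_ : (fun z => F (t, z)) = cst 0); last first.
    by apply/funext => z; rewrite /F patchE memNset// => -[].
  by rewrite Rintegral_cst// mul0r.
have cGS : continuous (fun t => G (t, S t) * v t).
  move=> t; apply: cvgM; last exact: cv.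
  apply: (@continuous_comp _ _ _ (fun t => (t, S t)) G); last exact: cG.
  by apply: continuous_pair => q; [exact: cvg_id|exact: cS].
have ic : mu.-integrable `]x, y] (EFin \o (fun=> c)).
  by apply: integrable_oc; exact: cst_continuous.
have iv := integrable_oc x y cv; have iGS := integrable_oc x y cGS.
have ikv := integrable_realZl k iv (measurable_itv _).
have ickv := integrable_realB ic ikv (measurable_itv _).
rewrite S_ftc// -RintegralZl// -(Rintegral_cst_oc c xy).
rewrite -RintegralB// -RintegralB//.
rewrite (Rintegral_subset_eq0 mu (K := `]x, y]%classic) (D := setT))//.
apply: ae_le_Rintegral => //.
- exact: (integrable_realB ickv iGS (measurable_itv _)).
- by apply: integrableS (integrable_Rintegral_slice1 iF).
have FF := ae_filter_ringOfSetsType mu.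
apply: filterS energy => t Et txy; rewrite FE//; apply: Et.
by move: txy; rewrite /= in_itv/= => /andP[xt ty]; rewrite (lt_trans x0)//= (le_lt_trans ty).
Qed.

(** The two majorants in the comparison of the rectangle with the swept region: a multiple of the
    first serves on the whole slab, the second only on the strip of levels that the front
    crosses. *)
Let error_part x y (C : R) : x <= y -> 0 < x -> y < T ->
  let F1 := (fun w => `|g w| + g w ^+ 2) \_ (`]x, y] `*` setT) in
  let F2 := (cst C) \_ (`]x, y] `*` `[S x, S y]) in
  [/\ (mu2 R).-integrable setT (EFin \o F1), (mu2 R).-integrable setT (EFin \o F2),
    \int[mu2 R]_w F1 w = \int[mu]_(t in `]x, y]) rho t &
    \int[mu2 R]_w F2 w = C * ((y - x) * (S y - S x))].
Proof.
move=> xy x0 yT F1 F2.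
have iF1 : (mu2 R).-integrable setT (EFin \o F1).
  apply: integrable_patch_plane; first by apply: measurableX => //; exact: measurable_itv.
  by apply: integrableS iabs => //; apply: measurableX => //; exact: measurable_itv.
pose K : set RR := `]x, y] `*` `[S x, S y].
have mK : measurable K by apply: measurableX; exact: measurable_itv.
have Sxy := S_nondecreasing x0 xy yT.
have itvE (e : bool) (p q : R) : p <= q ->
    (@lebesgue_measure R [set` Interval (BSide e p) (BRight q)] = (q - p)%:E)%E.
  move=> pq; have := @lebesgue_measure_itv R (Interval (BSide e p) (BRight q)).
  rewrite /= lte_fin => ->.
  by case: ltP => [//|qp]; congr EFin; apply/eqP; rewrite eq_sym subr_eq0 eq_le qp.
have muK : mu2 R K = ((y - x) * (S y - S x))%:E.
  by rewrite mu2_setX// !itvE// EFinM.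
have iF2 : (mu2 R).-integrable setT (EFin \o F2).
  apply: integrable_patch_plane => //; apply: measurable_bounded_integrable => //.
    by rewrite [X in (X < _)%E]muK ltry.
  by exists `|C|; split; [exact: num_real|move=> M CM w _ /=; exact: ltW].
split => //.
- rewrite -(Rintegral_slice1 iF1) (Rintegral_subset_eq0 mu (K := `]x, y]%classic) (D := setT))//.
    apply: eq_Rintegral => t /set_mem txy; rewrite /rho; apply: eq_Rintegral => z _.
    by rewrite /F1 patchE mem_set.
  move=> t txy; rewrite (_ : (fun z => F1 (t, z)) = cst 0); last first.
    by apply/funext => z; rewrite /F1 patchE memNset// => -[].
  by rewrite Rintegral_cst// mul0r.
- by rewrite -Rintegral_mkcond Rintegral_cst//; rewrite [X in fine X]muK.
Qed.

(** The energy increment is the integral over the old rectangle plus the energy of the new strip []S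
    x, S y]] at time [y]. The rectangle is compared with the swept region, and the strip with the
    flux of [G * v]: both are close to [G (y, S y) * (S y - S x)]. *)
Lemma energy_functional_nondecreasing a b : 0 < a -> a <= b -> b < T ->
  energy_functional a <= energy_functional b.
Proof.
move=> a_gt0 ab bT.
(* The factor 3 counts the errors of size [eta * (S y - S x)]: one from freezing [G] at [(y, S y)]
   in the new strip, one from freezing it in the boundary flux, one from the constant [C] of
   AM-GM. *)
pose m t := \int[mu]_(w in `]a, t]) rho w + 3 * S t.
apply: (@nondecreasing_of_local _ _ m) => // eta eta0.
pose A : set (R * R) := `[a, b] `*` `[0, S b].
have cA : compact A by apply: compact_setX; exact: segment_compact.
have [N N0 PN] : exists2 N, 0 < N & forall w, A w -> `|P w| <= N.
  have [M [_ PM]] : bounded_set (P @` A).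
    by apply: compact_bounded; apply: continuous_compact => //; exact: continuous_subspaceT.
  exists (`|M| + 1); first by rewrite ltr_wpDl.
  by move=> w Aw; apply: PM; [rewrite (le_lt_trans (ler_norm M))// ltrDl|exists w].
have [d1 d10 H1] := uniform_continuity_compact cA cP eta0.
have [d2 d20 H2] := uniform_continuity_compact cA cG eta0.
(* Half of [d2], because the conclusion of [uniform_continuity_compact] is a weak inequality whereas
   membership in the ball of radius [d2] is strict. *)
have [d3 d30 H3] := uniform_continuity_compact (@segment_compact _ a b) cS (divr_gt0 d20 (ltr0Sn R 1)).
(* AM-GM: [N * |g| <= eta * g ^+ 2 + C], used where the slab between [S x] and
   [S y] is not a full rectangle. *)
pose C := N ^+ 2 / (4 * eta).
have C0 : 0 < C by rewrite divr_gt0 ?exprn_gt0 ?mulr_gt0.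
(* The bound [eta / C] makes [C * (y - x) <= eta], so that the thin rectangle costs at most
   [eta * (S y - S x)]. *)
exists (Num.min (Num.min d1 d2) (Num.min d3 (eta / C))).
  by rewrite !lt_min d10 d20 d30 divr_gt0.
move=> x y ax xy yb; rewrite !lt_min => /andP[/andP[xy1 xy2] /andP[xy3 xyC]].
have x0 : 0 < x := lt_le_trans a_gt0 ax.
have yT : y < T := le_lt_trans yb bT.
have y0 : 0 < y := lt_le_trans x0 xy.
have Sxy := S_nondecreasing x0 xy yT.
have Syb := S_nondecreasing y0 yb bT.
have boxA t z : x <= t -> t <= y -> 0 <= z -> z <= S y -> A (t, z).
  by move=> xt ty z0 zS; split; rewrite /= in_itv/= ?z0 ?(le_trans ax) ?(le_trans ty) ?(le_trans zS).
have nearP t t' z : x <= t -> t <= y -> x <= t' -> t' <= y -> 0 <= z -> z <= S y ->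
    `|P (t, z) - P (t', z)| <= eta.
  move=> xt ty xt' ty' z0 zS; apply: H1; first exact: boxA.
  split => /=; last exact: ballxx.
  by rewrite /ball/= ltr_norml; lra.
have PN1 z : 0 <= z <= S x -> `|(P (x, z) + P (y, z)) / 2| <= N.
  move=> /andP[z0 zS]; have zy := le_trans zS Sxy.
  have p1 := PN _ (boxA x z (lexx _) xy z0 zy); have p2 := PN _ (boxA y z xy (lexx _) z0 zy).
  by move: p1 p2; rewrite !ler_norml => /andP[? ?] /andP[? ?]; lra.
have PN2 t z : x <= t <= y -> 0 <= z <= S t -> `|P (t, z)| <= N.
  move=> /andP[xt ty] /andP[z0 zS]; apply: PN; apply: boxA => //.
  by rewrite (le_trans zS)// S_nondecreasing// (lt_le_trans x0).
have [iF1 E1] := difference_part x0 xy yT PN1.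
have [iF2 E2] := swept_part x0 xy yT PN2.
have [iF3 iF4 E3 E4] := error_part C xy x0 yT.
set F1 := patch _ _ _ in iF1 E1; set F2 := patch _ _ _ in iF2 E2.
set F3 := patch _ _ _ in iF3 E3; set F4 := patch _ _ _ in iF4 E4.
(* The comparison is pointwise. For [0 < z < S x] both integrands are present and their test
   functions differ by at most [eta]; for [S x <= z <= S t] only [F2] is, and AM-GM absorbs it;
   elsewhere both vanish. *)
have F21 : \int[mu2 R]_w F2 w - \int[mu2 R]_w F1 w <=
    eta * (\int[mu]_(t in `]x, y]) rho t) + C * ((y - x) * (S y - S x)).
  rewrite -E3 -E4 -RintegralZl// -RintegralB// -RintegralD//; last exact: integrable_realZl.
  apply: le_Rintegral => //.
  - exact: integrable_realB.
  - by apply: integrable_realD => //; exact: integrable_realZl.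
  move=> [t z] _; rewrite /F1 /F2 /F3 /F4 !patchE !in_setX !mem_setE !in_itv/=.
  have sweptE : ((t, z) \in swept x y) = (x < t <= y) && (0 < z <= S t).
    apply/idP/idP => [/set_mem[/=]|/andP[xt z0]]; first by rewrite !in_itv/= => -> ->.
    by apply: mem_set; split; rewrite /= in_itv.
  rewrite sweptE in_setT andbT; have [/andP[xt ty]|_] /= := boolP (x < t <= y); last first.
    by rewrite subrr mulr0 addr0.
  have Sxt : S x <= S t by apply: S_nondecreasing => //; [exact: ltW|exact: le_lt_trans yT].
  have Sty : S t <= S y by apply: S_nondecreasing => //; exact: lt_trans xt.
  have F30 : 0 <= eta * (`|g (t, z)| + g (t, z) ^+ 2).
    by rewrite mulr_ge0 ?addr_ge0 ?sqr_ge0// ltW.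
  have F40 : 0 <= if S x <= z <= S y then C else 0 by case: ifP => // _; exact: ltW.
  have [z0|z0] := ltP 0 z; last by rewrite /= subrr addr_ge0.
  have [zS|Sz] := ltP z (S x) => /=.
    rewrite ifT; last by rewrite (le_trans (ltW zS)).
    have zy := le_trans (ltW zS) Sxy.
    have p1 := nearP t x z (ltW xt) ty (lexx _) xy (ltW z0) zy.
    have p2 := nearP t y z (ltW xt) ty xy (lexx _) (ltW z0) zy.
    have p3 : `|P (t, z) - (P (x, z) + P (y, z)) / 2| <= eta.
      by move: p1 p2; rewrite !ler_norml => /andP[? ?] /andP[? ?]; lra.
    rewrite -mulrBr; apply: (@le_trans _ _ (eta * `|g (t, z)|)).
      rewrite (le_trans (ler_norm _))// normrM mulrC ler_wpM2r//.
    by rewrite mulrDr -addrA lerDl addr_ge0// mulr_ge0 ?sqr_ge0// ltW.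
  rewrite subr0; have [zt|zt] := boolP (z <= S t); last first.
    by apply: addr_ge0 => //; case: ifP => // _; exact: ltW.
  rewrite (le_trans zt Sty).
  apply: (@le_trans _ _ (`|g (t, z)| * N)).
    rewrite (le_trans (ler_norm _))// normrM ler_wpM2l// PN2// ?(ltW xt) ?(ltW z0)//.
  have sq : eta * (`|g (t, z)| - N / (2 * eta)) ^+ 2 = eta * g (t, z) ^+ 2 - `|g (t, z)| * N + C.
    by rewrite -[g (t, z) ^+ 2]real_normK ?num_real// /C; field; rewrite gt_eqF.
  have : 0 <= eta * (`|g (t, z)| - N / (2 * eta)) ^+ 2 by rewrite mulr_ge0 ?sqr_ge0// ltW.
  have : 0 <= eta * `|g (t, z)| by rewrite mulr_ge0// ltW.
  by rewrite sq mulrDr; lra.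
have cGy := @slice_continuous G y cG; have cGx := @slice_continuous G x cG.
have split_y := Rintegral_oc_split (integrable_oc 0 (S y) cGy) (ltW (S_gt0 x)) Sxy (lexx _).
have E1' : \int[mu]_(z in `]0, S x]) (G (y, z) - G (x, z)) =
    \int[mu]_(z in `]0, S x]) G (y, z) - \int[mu]_(z in `]0, S x]) G (x, z).
  by rewrite RintegralB//; exact: integrable_oc.
pose G0 := G (y, S y); pose D := S y - S x.
have D0 : 0 <= D by rewrite subr_ge0.
have Sd2 t : x <= t -> t <= y -> `|S y - S t| < d2.
  move=> xt ty; apply: (@le_lt_trans _ _ (d2 / 2)); last by rewrite ltr_pdivrMr// ltr_pMr// ltr1n.
  apply: H3; first by rewrite /= in_itv/= yb (le_trans ax).
  by rewrite /ball/= ger0_norm ?subr_ge0// (le_lt_trans _ xy3)// lerD2l lerN2.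
have Ayy : A (y, S y) by apply: boxA => //; exact: ltW.
have Gy : (G0 - eta) * D <= \int[mu]_(z in `]S x, S y]) G (y, z).
  rewrite -(Rintegral_cst_oc _ Sxy); apply: le_Rintegral => //.
  - by apply: integrable_oc; exact: cst_continuous.
  - exact: integrable_oc.
  move=> z /=; rewrite in_itv/= => /andP[zx zy].
  have : `|G (y, S y) - G (y, z)| <= eta.
    apply: H2 => //; split; first exact: ballxx.
    rewrite /ball/= ger0_norm ?subr_ge0//; apply: le_lt_trans (Sd2 x (lexx _) xy).
    by rewrite ger0_norm ?subr_ge0// lerD2l lerN2 ltW.
  by rewrite /G0 ler_norml => /andP[_]; rewrite lerBlDr lerBlDl addrC.
have cGS : continuous (fun t => G (t, S t) * v t).
  move=> t; apply: cvgM; last exact: cv.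
  apply: (@continuous_comp _ _ _ (fun t => (t, S t)) G); last exact: cG.
  by apply: continuous_pair => q; [exact: cvg_id|exact: cS].
have Gv : \int[mu]_(t in `]x, y]) (G (t, S t) * v t) <= (G0 + eta) * D.
  have iv := integrable_oc x y cv.
  rewrite /D S_ftc// -RintegralZl//; apply: le_Rintegral => //.
  - exact: integrable_oc.
  - exact: integrable_realZl.
  move=> t /=; rewrite in_itv/= => /andP[xt ty].
  have : `|G (y, S y) - G (t, S t)| <= eta.
    apply: H2 => //; split; last by apply: Sd2 => //; exact: ltW.
    by rewrite /ball/= ger0_norm ?subr_ge0// (le_lt_trans _ xy2)// lerD2l lerN2 ltW.
  rewrite /G0 ler_norml => /andP[h _]; rewrite ler_wpM2r//.
  by move: h; rewrite lerNl opprB lerBlDl.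
have CD : C * ((y - x) * D) <= eta * D.
  by rewrite mulrA ler_wpM2r// mulrC -ler_pdivlMr// ltW.
have mE : m y - m x = \int[mu]_(t in `]x, y]) rho t + 3 * D.
  have irab : mu.-integrable `]a, b] (EFin \o rho) by exact: integrableS irho.
  rewrite /m -(Rintegral_oc_split irab ax xy yb).
  by rewrite /D; ring.
have efE : energy_functional y - energy_functional x =
    \int[mu2 R]_w F1 w + \int[mu]_(z in `]S x, S y]) G (y, z) - c * (y - x) + k * D.
  by rewrite -E1 E1' -split_y /energy_functional /D; ring.
rewrite mE efE; move: F21 E2; rewrite -/D.
move=> F21 E2; rewrite mulrDr; lra.
Qed.

End energy_growth.

(** * From the energy to the growth of the front *)

Lemma solution_growth (R : realType) (a0 gamma beta : R) (b : R -> R) (b_low b_up s0 : R)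
    (u0 : R -> R) (s : R -> R) (u : R * R -> R) :
  0 < a0 -> 0 < gamma -> 0 < beta -> 0 < b_low -> 0 < b_up ->
  (forall t, 0 < t -> b_low <= b t <= b_up) ->
  solution a0 gamma beta u0 s0 b s u ->
  let k := beta * gamma in let eps := 2 * gamma / b_up in
  exists C : R, forall t, 1 <= t -> 0 < s t /\
    beta * b_low / 2 * t <= (1 + k * s t) ^+ 2 / (2 * eps) * s t + k / a0 * s t + C.
Proof.
move=> a0_gt0 gamma_gt0 beta_gt0 bl0 bu0 bb sol k eps.
have eps0 : 0 < eps by rewrite divr_gt0// mulr_gt0.
have k0 : 0 < k by rewrite mulr_gt0.
pose c := beta * b_low / 2.
pose G1 z := (1 + k * z) * u (1, z) - eps / 2 * u (1, z) ^+ 2.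
(* The derivatives and extensions obtained from [sol] depend on the horizon [T], which will depend
   on [t]. The constant therefore mentions only [s] and [u] at time 1; a positive starting time is
   taken because the increment formulas hold on the open time interval. *)
exists (c - \int[@lebesgue_measure R]_(z in `]0, s 1]) G1 z - k / a0 * s 1) => t t1.
(* Any horizon beyond [t] would do: monotonicity of the energy requires [t < T] strictly. *)
pose T := t + 1.
have tT : t < T by rewrite ltrDl.
have t0 : 0 < t by rewrite (lt_le_trans ltr01).
have T0 : 0 < T := lt_trans t0 tT.
have [s_t [u_t [u_z [u_zz [[H1 H2 [Hsl _]] [heat bcl bcr stE _]]]]]] := sol T T0.
have [cs [_ _ ws] s_gt0] := H1.
have [cu _ [wut [mut _]] _ [wuzz L2]] := H2.
have slice_u r : 0 <= r <= T ->
    weak_derivative1 `]0, s r[ (fun z => u (r, z)) (fun z => u_z (r, z)).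
  by move=> /Hsl[].
pose S := s_ext s T; pose v := speed a0 s u T; pose U := u_ext s u T.
pose g := u_zz0 s T u_zz.
pose P (w : R * R) := 1 + k * w.2 - eps * U w.
pose G (w : R * R) := (1 + k * w.2) * U w - eps / 2 * U w ^+ 2.
have cU : continuous U by exact: u_ext_continuous.
have cphi : continuous (fun w : R * R => 1 + k * w.2).
  move=> w; apply: cvgD; first exact: cvg_cst.
  by apply: cvgM; [exact: cvg_cst|exact: cvg_snd].
have cP : continuous P.
  by move=> w; apply: cvgB; [exact: cphi|apply: cvgM; [exact: cvg_cst|exact: cU]].
have cG : continuous G.
  move=> w; apply: cvgB; first by apply: cvgM; [exact: cphi|exact: cU].
  by apply: cvgM; [exact: cvg_cst|apply: cvgM; exact: cU].
have SE r : 0 <= r <= T -> S r = s r by exact: s_extE.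
have S0 r : 0 < S r by exact: s_ext_gt0.
have := @energy_functional_nondecreasing R S v U P G g c (k / a0) T.
move=> /(_ _ _ cP cG S0 _ _ _ _ _ _ _ 1 t ltr01 t1 tT) mono.
have {}mono : energy_functional S G c (k / a0) 1 <= energy_functional S G c (k / a0) t.
  apply: mono.
  - exact: s_ext_continuous.
  - exact: speed_continuous.
  - by move=> r; exact: speed_ge0.
  - by move=> x y x0 xy yT; exact: (s_ext_ftc _ cs ws s_gt0 cu stE).
  - exact: integrable_u_zz0.
  - exact: integrable_u_zz0_sqr.
  - by move=> x y x0 xy yT; exact: (u_ext_time_ftc _ _ cs ws s_gt0 cu mut wut wuzz L2 heat stE).
  - by move=> x y z; rewrite /G /P /=; field.
  have FF := ae_filter_ringOfSetsType (@lebesgue_measure R).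
  have en := slice_energy a0_gt0 gamma_gt0 beta_gt0 T0 cs ws s_gt0 cu wuzz L2 slice_u bcl bcr stE (ltW eps0).
  apply: filterS en => r en r0T; apply: le_trans (en r0T).
  set us := U (r, S r); rewrite -/us -/k.
  have vE : v r = a0 * sigma us by [].
  rewrite -/(v r) vE; set q := sigma us.
  have q0 : 0 <= q by exact: sigma_ge0.
  have usq : us <= q by exact: le_sigma.
  have /andP[bl bu] : b_low <= b r <= b_up by apply: bb; case/andP: r0T.
  (* The surplus over the claimed rate has three nonnegative parts: what is left of the influx after
     [b r <= b_up] has bounded the quadratic price by half of it, the gap [k * (q - us)] between
     [sigma] and the identity, and [eps / 2 * us ^+ 2] times the speed. *)
  have h1 : k / a0 * (a0 * q) = k * q by field; rewrite gt_eqF.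
  have h2 : eps * beta * b r ^+ 2 / (4 * gamma) = beta * (b r ^+ 2 / (2 * b_up)).
    by rewrite /eps; field; rewrite !gt_eqF.
  have h3 : b r ^+ 2 / (2 * b_up) <= b r / 2.
    by rewrite ler_pdivrMr ?mulr_gt0//; nra.
  have h4 : beta * (b r ^+ 2 / (2 * b_up)) <= beta * (b r / 2) by rewrite ler_pM2l.
  have h5 : beta * b_low <= beta * b r by rewrite ler_pM2l.
  have h6 : 0 <= k * (q - us) by rewrite mulr_ge0 ?subr_ge0// ltW.
  have h7 : 0 <= eps / 2 * us ^+ 2 * (a0 * q).
    exact: mulr_ge0 (mulr_ge0 (divr_ge0 (ltW eps0) (ler0n _ 2)) (sqr_ge0 _)) (mulr_ge0 (ltW a0_gt0) q0).
  change (u_ext s u T (r, s_ext s T r)) with us; change (s_ext s T r) with (S r).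
  rewrite h1 h2 /c /G /= -/us; lra.
have tT0 : 0 <= t <= T by rewrite !ltW.
have oneT : (0 : R) <= 1 <= T by rewrite ler01 (le_trans t1)// ltW.
split; first exact: s_gt0.
have slG r : continuous (fun z => G (r, z)).
  move=> z; apply: (@continuous_comp _ _ _ (fun z => (r, z)) G); last exact: cG.
  by apply: continuous_pair => q; [exact: cvg_cst|exact: cvg_id].
have ioc (f : R -> R) x y : continuous f -> (@lebesgue_measure R).-integrable `]x, y] (EFin \o f).
  move=> cf; apply: integrableS (integrable_continuous x y cf) => //.
  by apply: subset_itvr; rewrite bnd_simp.
have e1 : \int[@lebesgue_measure R]_(z in `]0, S 1]) G (1, z) =
    \int[@lebesgue_measure R]_(z in `]0, s 1]) G1 z.
  rewrite SE//; apply: eq_Rintegral => z; rewrite inE/= in_itv/= => /andP[z0 zs].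
  by rewrite /G /G1 /U u_extE// (ltW z0).
have e2 : \int[@lebesgue_measure R]_(z in `]0, S t]) G (t, z) <=
    (1 + k * s t) ^+ 2 / (2 * eps) * s t.
  rewrite -SE// -[X in _ * X]subr0 -Rintegral_cst_oc ?(ltW (S0 t))//.
  apply: le_Rintegral => //; [exact: ioc|by apply: ioc; exact: cst_continuous|].
  move=> z /=; rewrite in_itv/= => /andP[z0 zS].
  apply: (@le_trans _ _ ((1 + k * z) ^+ 2 / (2 * eps))).
    rewrite -subr_ge0 /G/= (_ : _ - _ = (1 + k * z - eps * U (t, z)) ^+ 2 / (2 * eps)).
      by rewrite divr_ge0 ?sqr_ge0// mulr_ge0// ltW.
    by field; rewrite gt_eqF.
  have kz0 : 0 <= 1 + k * z by rewrite addr_ge0// mulr_ge0 ?ltW.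
  have kzS : 1 + k * z <= 1 + k * S t by rewrite lerD2l ler_pM2l.
  have e20 : 0 < 2 * eps by rewrite mulr_gt0.
  by rewrite ler_pM2r ?invr_gt0// ler_pXn2r ?nnegrE// (le_trans kz0).
move: mono; rewrite /energy_functional e1 (SE 1)// (SE t)// mulr1.
rewrite -/c; move: e2; rewrite (SE t)//.
move: (_ / (2 * eps) * s t) (k / a0 * s t) (k / a0 * s 1) (c * t) => X Y Z W.
move: (Rintegral _ _ _) (Rintegral _ _ _) => I1 I2; lra.
Qed.

Unset Implicit Arguments.

Theorem theorem6p2 (R : realType) (a0 gamma beta : R)
    (b : R -> R) (b_inf b_low b_up : R) (s0 : R) (u0 : R -> R)
    (s : R -> R) (u : R * R -> R)
    (hA1 : assumption_A1 a0 gamma beta)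
    (hA2 : assumption_A2' b b_inf b_low b_up)
    (hA3 : assumption_A3 gamma b_up s0 u0)
    (hsol : solution a0 gamma beta u0 s0 b s u) :
  s t @[t --> +oo] --> +oo.
Proof.
have [a0_gt0 gamma_gt0 beta_gt0] := hA1.
have [_ _ _ _ [bl0 bu0 bb]] := hA2.
have [C HC] := solution_growth a0_gt0 gamma_gt0 beta_gt0 bl0 bu0 bb hsol.
set k := beta * gamma in HC; set eps := 2 * gamma / b_up in HC.
have k0 : 0 < k by rewrite mulr_gt0.
have eps0 : 0 < eps by rewrite divr_gt0// mulr_gt0.
have c0 : 0 < beta * b_low / 2 by rewrite divr_gt0// mulr_gt0.
apply/cvgryPge => A.
(* [B] is the cubic bound evaluated at [A]. As [s t] is positive and the cubic increases on positive
   arguments, [s t < A] would force [beta * b_low / 2 * t <= B], which fails for large [t]. *)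
pose B := (1 + k * A) ^+ 2 / (2 * eps) * A + k / a0 * A + C.
near=> t.
have t1 : 1 <= t by near: t; apply: nbhs_pinfty_ge; exact: num_real.
have tB : B / (beta * b_low / 2) < t by near: t; apply: nbhs_pinfty_gt; exact: num_real.
have [st0 Ht] := HC t t1.
rewrite leNgt; apply/negP => sA.
have : beta * b_low / 2 * t <= B.
  apply: (le_trans Ht); rewrite /B lerD2r lerD//; last first.
    by rewrite ler_pM2l ?divr_gt0// ltW.
  have ks0 : 0 <= 1 + k * s t by rewrite addr_ge0// mulr_ge0 ?ltW.
  have e20 : 0 < 2 * eps by rewrite mulr_gt0.
  have sA2 : 1 + k * s t <= 1 + k * A by rewrite lerD2l ler_pM2l// ltW.
  apply: ler_pM; [by rewrite divr_ge0 ?sqr_ge0// ltW|exact: ltW| |exact: ltW].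
  by rewrite ler_pM2r ?invr_gt0// ler_pXn2r ?nnegrE// (le_trans ks0).
by rewrite leNgt mulrC -ltr_pdivrMr// tB.
Unshelve. all: by end_near. Qed.
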